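(* Let $k$ be a field and let $R = k[X^3, X^2Y, XY^2, Y^3, X^2Z, Y^2Z, XZ^2, YZ^2, Z^3]$, the $k$-subalgebra of the polynomial ring $k[X,Y,Z]$ generated by these nine monomials, regarded as a standard graded $k$-algebra in which each of the nine generating monomials has degree $1$. Then $R$ is Koszul.
   Context: A standard graded $k$-algebra is a commutative graded $k$-algebra $R=\bigoplus_{n\ge 0} R_n$ with $R_0=k$ that is generated as a $k$-algebra by the finite-dimensional space $R_1$. It is called Koszul if its residue field $k=R/\bigoplus_{n\geq 1}R_n$ has a linear free resolution as an $R$-module, i.e. $\operatorname{Tor}_i^R(k,k)_j=0$ for all $i\ge 0$ and all $j\neq i$, where the subscript $j$ denotes the graded component of internal degree $j$. *)

(* Defs.v *)
From HB Require Import structures.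
From mathcomp Require Import all_boot all_order all_algebra.
From mathcomp Require Import boolp.
From mathcomp Require Import mpoly.

Set Implicit Arguments.
Unset Strict Implicit.
Unset Printing Implicit Defensive.

Import GRing.Theory.
Local Open Scope ring_scope.

(* Since [comAlgType k] excludes the zero ring, [gpart0] says that k -> A_0 is *)
(* an isomorphism.                                                             *)
Record stdGradedAlgebra (k : fieldType) := StdGradedAlgebra {
  sga_sort :> comAlgType k;
  gpart : nat -> sga_sort -> Prop;
  gpart_lin : forall n (c : k) (x y : sga_sort),
    gpart n x -> gpart n y -> gpart n (c *: x + y);
  gpartM : forall m n (x y : sga_sort),
    gpart m x -> gpart n y -> gpart (m + n)%N (x * y);
  gpart0 : forall x : sga_sort, gpart 0 x <-> exists c : k, x = c%:A;
  gpart_span : forall x : sga_sort, exists (n : nat) (y : nat -> sga_sort),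
    (forall i, gpart i (y i)) /\ x = \sum_(i < n) y i;
  gpart_direct : forall (n : nat) (y : nat -> sga_sort),
    (forall i, gpart i (y i)) -> \sum_(i < n) y i = 0 ->
    forall i, (i < n)%N -> y i = 0;
  gpart1_findim : exists (n : nat) (g : 'I_n -> sga_sort),
    (forall i, gpart 1 (g i)) /\
    forall x, gpart 1 x -> exists c : 'I_n -> k, x = \sum_i c i *: g i;
  gpart1_gen : forall B : sga_sort -> Prop,
    B 1 ->
    (forall (c : k) x y, B x -> B y -> B (c *: x + y)) ->
    (forall x y, B x -> B y -> B (x * y)) ->
    (forall x, gpart 1 x -> B x) ->
    forall x, B x
}.

Section Koszul.
Variables (k : fieldType) (A : stdGradedAlgebra k).

Definition gpartz (m : int) (x : A) : Prop :=
  if m is Posz n then gpart n x else x = 0.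

Definition irrelevant (x : A) : Prop :=
  exists (n : nat) (y : nat -> A),
    (forall i, gpart i.+1 (y i)) /\ x = \sum_(i < n) y i.

(* A graded free resolution of the residue field k = A / A_+ by the modules    *)
(* F_i = \bigoplus_p A(- res_shift i p), written as row vectors:               *)
(*   ... --> F_2 --> F_1 --> F_0 --> A / A_+ --> 0.                            *)
(* The differential F_(i.+1) -> F_i is v |-> v *m res_diff i. The map from F_0 *)
(* to the cyclic module A / A_+ is v |-> v *m res_aug modulo A_+; it is onto   *)
(* as soon as 1 is in its image.                                               *)
Record gradedFreeResolution := GradedFreeResolution {
  res_rank : nat -> nat;
  res_shift : forall i, 'I_(res_rank i) -> int;
  res_diff : forall i, 'M[A]_(res_rank i.+1, res_rank i);
  res_aug : 'cV[A]_(res_rank 0);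
  res_diff_homog : forall i p q,
    gpartz (res_shift p - res_shift q) (res_diff i p q);
  res_aug_homog : forall p, gpartz (res_shift p) (res_aug p ord0);
  res_aug_onto : exists v : 'rV[A]_(res_rank 0),
    irrelevant (1 - (v *m res_aug) ord0 ord0);
  res_exact0 : forall v : 'rV[A]_(res_rank 0),
    irrelevant ((v *m res_aug) ord0 ord0) <->
    exists w : 'rV[A]_(res_rank 1), v = w *m res_diff 0;
  res_exactS : forall i (v : 'rV[A]_(res_rank i.+1)),
    v *m res_diff i = 0 <->
    exists w : 'rV[A]_(res_rank i.+2), v = w *m res_diff i.+1
}.

(* Every basis element of F_i has degree i, so that the entries of the         *)
(* differentials have degree 1 and Tor_i(k, k) = H_i(F / A_+ F), a             *)
(* subquotient of F_i / A_+ F_i, is concentrated in internal degree i.         *)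
Definition linear_resolution (F : gradedFreeResolution) : Prop :=
  forall i (p : 'I_(res_rank F i)), res_shift p = i%:Z.

Definition koszul : Prop :=
  exists F : gradedFreeResolution, linear_resolution F.

End Koszul.

Section PinchedVeronese.
Variable k : fieldType.

Definition varX : {mpoly k[3]} := 'X_(@Ordinal 3 0 isT).
Definition varY : {mpoly k[3]} := 'X_(@Ordinal 3 1 isT).
Definition varZ : {mpoly k[3]} := 'X_(@Ordinal 3 2 isT).

Definition pv_gens : 9.-tuple {mpoly k[3]} :=
  [tuple varX ^+ 3; varX ^+ 2 * varY; varX * varY ^+ 2; varY ^+ 3;
         varX ^+ 2 * varZ; varY ^+ 2 * varZ;
         varX * varZ ^+ 2; varY * varZ ^+ 2; varZ ^+ 3].

(* The subalgebra generated by [pv_gens], as the image of k[T_0, ..., T_8].    *)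
Definition pv_pred : {pred {mpoly k[3]}} :=
  fun f => `[< exists q : {mpoly k[9]}, f = q \mPo pv_gens >].

Lemma pv_predP f :
  reflect (exists q : {mpoly k[9]}, f = q \mPo pv_gens) (f \in pv_pred).
Proof. exact: asboolP. Qed.

Fact pv_subalg_closed : subalg_closed pv_pred.
Proof.
split; first by apply/pv_predP; exists 1; rewrite rmorph1.
- move=> c _ _ /pv_predP[p ->] /pv_predP[q ->]; apply/pv_predP.
  by exists (c *: p + q); rewrite linearP.
- move=> _ _ /pv_predP[p ->] /pv_predP[q ->]; apply/pv_predP.
  by exists (p * q); rewrite rmorphM.
Qed.

HB.instance Definition _ :=
  GRing.isSubalgClosed.Build k {mpoly k[3]} pv_pred pv_subalg_closed.

Record pv_type := PvType { pv_val :> {mpoly k[3]}; _ : pv_val \in pv_pred }.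
HB.instance Definition _ := [isSub for pv_val].
HB.instance Definition _ := [Choice of pv_type by <:].
HB.instance Definition _ := [SubChoice_isSubComNzRing of pv_type by <:].
HB.instance Definition _ := [SubZmodule_isSubLmodule of pv_type by <:].
HB.instance Definition _ := [SubNzRing_SubLmodule_isSubLalgebra of pv_type by <:].
HB.instance Definition _ := [SubLalgebra_isSubAlgebra of pv_type by <:].

Lemma pv_valD : {morph pv_val : x y / x + y}. Proof. by []. Qed.
Lemma pv_valZ c : {morph pv_val : x / c *: x}. Proof. by []. Qed.
Lemma pv_valM : {morph pv_val : x y / x * y}. Proof. by []. Qed.
Lemma pv_val_sum I (r : seq I) (P : pred I) (F : I -> pv_type) :
  pv_val (\sum_(i <- r | P i) F i) = \sum_(i <- r | P i) pv_val (F i).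
Proof. exact: (big_morph pv_val pv_valD). Qed.

Definition pv_eval (q : {mpoly k[9]}) : pv_type :=
  PvType (introT (pv_predP _) (ex_intro _ q erefl)).

Lemma pv_evalP (x : pv_type) : exists q, x = pv_eval q.
Proof. by case: x => f fP; case/pv_predP: (fP) => q E; exists q; exact/val_inj. Qed.

(* The grading in which each of the nine generators has degree 1 (and not its  *)
(* degree 3 in k[X, Y, Z]).                                                    *)
Definition pv_gpart (n : nat) (x : pv_type) : Prop :=
  exists2 q : {mpoly k[9]}, q \is n.-homog & x = pv_eval q.

Lemma dhomogXi n (i : 'I_n) : ('X_i : {mpoly k[n]}) \is 1.-homog.
Proof. by rewrite dhomogX; apply/eqP; exact: mdeg1. Qed.

Fact pv_gens_homog i : tnth pv_gens i \is 3.-homog.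
Proof.
have hX := @dhomogXi 3.
have h2 j : ('X_j ^+ 2 : {mpoly k[3]}) \is 2.-homog.
  exact: (dhomogMn 2 (hX j)).
have h3 j : ('X_j ^+ 3 : {mpoly k[3]}) \is 3.-homog.
  exact: (dhomogMn 3 (hX j)).
have h12 j l : ('X_j * 'X_l ^+ 2 : {mpoly k[3]}) \is 3.-homog.
  exact: (dhomogM (hX _) (h2 _)).
have h21 j l : ('X_j ^+ 2 * 'X_l : {mpoly k[3]}) \is 3.-homog.
  exact: (dhomogM (h2 _) (hX _)).
rewrite (tnth_nth 0); case: i => m /= lt_m9.
do 9?[case: m lt_m9 => [_|m lt_m9] /=;
  first by [exact: h3 | exact: h21 | exact: h12]].
by [].
Qed.

Fact pv_eval_homog n q : q \is n.-homog -> pv_val (pv_eval q) \is (3 * n).-homog.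
Proof.
move=> /dhomogP qh; rewrite /= comp_mpolyE big_seq.
apply: rpred_sum => m /qh /= mn; apply: rpredZ.
have -> : (3 * n = \sum_(i < 9) 3 * m i)%N by rewrite -mn mdegE big_distrr.
elim/big_rec2: _ => [|i d p _ ph]; first exact: dhomog1.
by apply: dhomogM ph; apply: dhomogMn; exact: pv_gens_homog.
Qed.

Fact pv_gpart_lin n c x y : pv_gpart n x -> pv_gpart n y -> pv_gpart n (c *: x + y).
Proof.
move=> [p hp ->] [q hq ->]; exists (c *: p + q); first by rewrite rpredD ?rpredZ.
by apply/val_inj; rewrite /= linearP.
Qed.

Fact pv_gpartM m n x y : pv_gpart m x -> pv_gpart n y -> pv_gpart (m + n)%N (x * y).
Proof.
move=> [p hp ->] [q hq ->]; exists (p * q); first exact: dhomogM.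
by apply/val_inj; rewrite /= rmorphM.
Qed.

Fact pv_gpart0 x : pv_gpart 0 x <-> exists c : k, x = c%:A.
Proof.
have valC c : pv_val (c%:A) = c%:MP.
  by rewrite pv_valZ -mul_mpolyC; exact: mulr1.
split=> [[q /dhomogP hq ->]|[c ->]].
  exists (q@_0%MM); apply/val_inj; rewrite [RHS]valC.
  rewrite -(comp_mpolyC _ pv_gens); congr (_ \mPo _).
  apply/mpolyP => m; rewrite mcoeffC.
  have [->|m0] := eqVneq 0%MM m; first by rewrite mulr1.
  rewrite mulr0; apply: memN_msupp_eq0; apply/negP => /hq/eqP.
  by rewrite mdeg_eq0 => /eqP E; rewrite E eqxx in m0.
exists c%:MP; first by rewrite -[c%:MP]mulr1 mul_mpolyC rpredZ ?dhomog1.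
by apply/val_inj; rewrite [LHS]valC /= comp_mpolyC.
Qed.

Fact pv_gpart_span x : exists (n : nat) (y : nat -> pv_type),
  (forall i, pv_gpart i (y i)) /\ x = \sum_(i < n) y i.
Proof.
have [q ->] := pv_evalP x.
exists (msize q), (fun i => pv_eval (pihomog mdeg i q)); split.
  by move=> i; exists (pihomog mdeg i q) => //; exact: pihomogP.
apply/val_inj; rewrite /= pv_val_sum /= -raddf_sum /=.
by rewrite -pihomog_partitionE.
Qed.

Fact pv_gpart_direct n (y : nat -> pv_type) :
  (forall i, pv_gpart i (y i)) -> \sum_(i < n) y i = 0 ->
  forall i, (i < n)%N -> y i = 0.
Proof.
move=> hy y0 i ltin; apply/val_inj => /=.
have hv j : pv_val (y j) \is (3 * j).-homog.
  by have [q qh ->] := hy j; exact: pv_eval_homog.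
have := congr1 (pihomog mdeg (3 * i) \o pv_val) y0.
rewrite /= pv_val_sum raddf_sum /= (bigD1 (Ordinal ltin)) //= pihomog_dE //.
rewrite big1 ?addr0 ?pihomog0 // => j ji.
by rewrite (pihomog_ne0 _ (hv j)) // eqn_pmul2l.
Qed.

Fact pv_gpart1_findim : exists (n : nat) (g : 'I_n -> pv_type),
  (forall i, pv_gpart 1 (g i)) /\
  forall x, pv_gpart 1 x -> exists c : 'I_n -> k, x = \sum_i c i *: g i.
Proof.
exists 9, (fun i => pv_eval 'X_i); split=> [i|_ [q /dhomogP hq ->]].
  by exists 'X_i => //; exact: dhomogXi.
exists (fun i => q@_U_(i)); apply/val_inj; rewrite /= pv_val_sum /=.
have -> : q = \sum_i q@_U_(i) *: 'X_i.
  apply/mpolyP => m; rewrite raddf_sum /=.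
  have [/mdeg1P[i /eqP ->]|m1] := boolP (mdeg m == 1)%N.
    rewrite (bigD1 i) //= mcoeffZ mcoeffX eqxx mulr1 big1 ?addr0 // => j ji.
    by rewrite mcoeffZ mcoeffX eq_mnm1 (negPf ji) mulr0.
  rewrite memN_msupp_eq0; last by apply/negP => /hq/eqP; exact/negP.
  rewrite big1 // => j _; rewrite mcoeffZ mcoeffX.
  have [jm|] := eqVneq U_(j)%MM m; last by rewrite mulr0.
  by rewrite -jm mdeg1 in m1.
rewrite raddf_sum /=; apply: eq_bigr => i _; rewrite comp_mpolyZ.
congr (_ *: _); rewrite raddf_sum (bigD1 i) //= mcoeffZ mcoeffX eqxx mulr1.
by rewrite big1 ?addr0 // => j ji; rewrite mcoeffZ mcoeffX eq_mnm1 (negPf ji) mulr0.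
Qed.

Fact pv_gpart1_gen (B : pv_type -> Prop) :
  B 1 ->
  (forall (c : k) x y, B x -> B y -> B (c *: x + y)) ->
  (forall x y, B x -> B y -> B (x * y)) ->
  (forall x, pv_gpart 1 x -> B x) ->
  forall x, B x.
Proof.
move=> B1 Bl BM Bg x; have [q ->] := pv_evalP x.
have B0 : B 0 by have := Bl (-1) 1 1 B1 B1; rewrite scaleN1r addNr.
have evalE p r c : pv_eval (c *: p + r) = c *: pv_eval p + pv_eval r.
  by apply/val_inj; rewrite /= linearP.
have evalM p r : pv_eval (p * r) = pv_eval p * pv_eval r.
  by apply/val_inj; rewrite /= rmorphM.
rewrite [q]mpolyE; elim/big_rec: _ => [|m p _ Bp].
  by have -> : pv_eval 0 = 0 by apply/val_inj; rewrite /= raddf0.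
rewrite evalE; apply: Bl Bp; rewrite mpolyXE_id.
have eval1 : B (pv_eval 1).
  by have -> : pv_eval 1 = 1 by apply/val_inj; rewrite /= rmorph1.
elim/big_rec: _ => // i r _ Br; rewrite evalM; apply: (BM) Br.
elim: (m i) => // d IH; rewrite exprS evalM; apply: (BM) IH; apply: Bg.
by exists 'X_i => //; exact: dhomogXi.
Qed.

Definition pinchedVeronese : stdGradedAlgebra k :=
  StdGradedAlgebra pv_gpart_lin pv_gpartM pv_gpart0 pv_gpart_span
    pv_gpart_direct pv_gpart1_findim pv_gpart1_gen.

End PinchedVeronese.

(* Main.v *)
Require Import Defs.
From Stdlib Require Import ZArith.
From mathcomp Require Import all_boot all_algebra.
From mathcomp Require Import boolp mpoly zify.

(* R has a basis of monomials X^u, where u runs over the exponent vectors with *)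
(* 3 | |u| and u <> (1,1,1). Give the generators the weights                   *)
(*   X^2Y, Y^2Z, Z^2X : 0     XY^2, YZ^2, ZX^2 : 3     X^3, Y^3, Z^3 : 6       *)
(* and X^u the least weight of a factorization. The associated graded ring has *)
(* the same monomial basis, with X^u * X^v = X^(u+v) or 0 according to whether *)
(* the weights add up. Unlike R itself, it has a Koszul filtration by ideals   *)
(* generated by variables: 21 ideals, each with an order on its generators     *)
(* such that every colon ideal (earlier generators) : (next generator) is      *)
(* again one of the 21. Their colon conditions quantify over all u but are     *)
(* periodic in u, and so amount to a finite computation.                       *)
(*                                                                             *)
(* The filtration gives a linear resolution over the associated graded ring,   *)
(* and it lifts to R. In a fixed multidegree d, a free R-module with basis in  *)
(* multidegrees gam q has as elements the vectors c in k^I supported on the q  *)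
(* with X^(d - gam q) in R, and multiplication by monomials does not change c. *)
(* Hence it is enough to lift syzygies of initial terms by triangular          *)
(* elimination, one multidegree at a time.                                     *)

Set Implicit Arguments.
Unset Strict Implicit.
Unset Printing Implicit Defensive.

Import GRing.Theory.
Local Open Scope ring_scope.

(** * Lifting linear resolutions from the associated graded ring *)

(** The resolution is built one free module at a time by a Groebner basis argument in the style of
    Schreyer. Each basis element q of the current free module carries a multidegree, a weight and a
    state of the filtration. The invariant [stage_ok] says that the module of syzygies still to be
    resolved has as initial module the direct sum of the ideals attached to the states.

    Under this invariant every pair of a basis element q and a generator x listed for its state
    yields a syzygy with leading term x q, and these pairs index the next free module. Division by
    leading terms ([syz_expand]) shows that the chosen syzygies generate. Always dividing by the
    first listed generator makes the normal form unique ([reduced_next], [next_free]). The relations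
    among them then have the colon ideals as initial ideals ([next_cover]), and these are again
    states, so the invariant persists ([stage_step]). Each step raises the multidegree by one
    generator, which makes the resolution linear ([mdeg_pv_ix]).

    The facts special to R are subadditivity of the weight ([weight_add]), and the colon conditions
    together with the root state being the maximal ideal ([inlat_vec_ok]). The latter reduces by
    periodicity ([reducible_stable]) to [irreducible_check]. Exactness over R is assembled from
    multidegrees in [apply_diff_eq0] and [apply_diff_image]. *)

Lemma lex_code B a a' b b' : (b <= B)%N -> (b' <= B)%N ->
  (a * B.+1 + b < a' * B.+1 + b')%N = (a < a')%N || (a == a') && (b < b')%N.
Proof.
move=> leb leb'; case: (ltngtP a a') => [lt|lt|->] /=; last by rewrite ltn_add2l.
- by have := leq_mul lt (leqnn B.+1); rewrite mulSn; lia.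
- by have := leq_mul lt (leqnn B.+1); rewrite mulSn; lia.
Qed.

Lemma lex_code_inj B a a' b b' : (b <= B)%N -> (b' <= B)%N ->
  (a * B.+1 + b = a' * B.+1 + b')%N -> b = b'.
Proof.
by move=> leb leb' /(congr1 (modn^~ B.+1)); rewrite !modnMDl !modn_small.
Qed.

Section Stages.
Variables (k : fieldType) (n : nat) (L : pred 'X_{1..n}) (om : 'X_{1..n} -> nat).
Variables (G T : Type) (x : G -> 'X_{1..n}) (out : T -> seq (G * T)).

(* x e.1 divides u in the associated graded ring. *)
Definition leaddiv (u : 'X_{1..n}) (e : G * T) : bool :=
  [&& (x e.1 <= u)%MM, L (u - x e.1)%MM
    & om (u - x e.1)%MM + om (x e.1) == om u]%N.

Definition initial_ideal (s : T) (u : 'X_{1..n}) : bool := has (leaddiv u) (out s).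

Hypothesis L0 : L 0%MM.
Hypothesis LD : forall u v, L u -> L v -> L (u + v)%MM.
Hypothesis Lx : forall g, L (x g).
Hypothesis om0 : om 0%MM = 0%N.
Hypothesis omD : forall u v, L u -> L v -> (om (u + v)%MM <= om u + om v)%N.
(* A state s stands for the ideal generated by the variables listed in out s;  *)
(* the ideal of the successor state is the colon ideal of the earlier          *)
(* variables by the current one.                                               *)
Hypothesis linear_quotients : forall s (j : 'I_(size (out s))) u, L u ->
  let e := tnth (in_tuple (out s)) j in
  initial_ideal e.2 u =
  (om (u + x e.1)%MM < om u + om (x e.1))%N
  || has (leaddiv (u + x e.1)%MM) (take j (out s)).

(* A free module with basis ix and, in each multidegree d, a space of          *)
(* coefficient vectors syz d: the next module of syzygies to be resolved. The  *)
(* initial terms of its elements are the monomial multiples u * q with u in    *)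
(* the ideal of st q; wt and pos define the term order.                        *)
Record stage := Stage {
  ix : finType;
  gam : ix -> 'X_{1..n};
  wt : ix -> nat;
  st : ix -> T;
  pos : ix -> nat;
  syz : 'X_{1..n} -> (ix -> k) -> Prop
}.

Definition insupp (S : stage) (d : 'X_{1..n}) (q : ix S) : bool :=
  (gam q <= d)%MM && L (d - gam q)%MM.

(** The lexicographic order on pairs of weight and [pos], coded as one number so that it can serve
    for induction and maximization. *)
Definition rank (S : stage) (d : 'X_{1..n}) (q : ix S) : nat :=
  ((om (d - gam q)%MM + wt q) * (\max_(q : ix S) pos q).+1 + pos q)%N.

Definition reduced (S : stage) (d : 'X_{1..n}) (q : ix S) : bool :=
  insupp d q && ~~ initial_ideal (st q) (d - gam q)%MM.

(** [syz_cover] provides a reduced Groebner basis element, multiplied up, for every monomial of the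
    expected initial module; [syz_free] says that no further leading terms occur. *)
Record stage_ok (S : stage) : Prop := StageOk {
  pos_inj : injective (@pos S);
  syz_supp : forall d c q, @syz S d c -> c q != 0 -> insupp d q;
  syz0 : forall d, @syz S d (fun=> 0);
  syz_lin : forall d c c' a, @syz S d c -> @syz S d c' ->
    @syz S d (fun q => c q + a * c' q);
  syz_shift : forall d u c, L u -> @syz S d c -> @syz S (d + u)%MM c;
  syz_cover : forall d q, @insupp S d q -> initial_ideal (st q) (d - gam q)%MM ->
    exists2 c, @syz S d c & c q = 1 /\
      forall q', c q' != 0 -> q' != q -> reduced d q' /\ (rank d q' < rank d q)%N;
  syz_free : forall d c, @syz S d c -> (forall q, c q != 0 -> reduced d q) ->
    forall q, c q = 0
}.

Definition lincomb (I J : finType) (c : I -> k) (C : I -> J -> k) : J -> k :=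
  fun q => \sum_p c p * C p q.

(** [C] is the matrix of a differential with its monomials stripped: the multidegrees determine
    them. [link_image] and [link_ker] express exactness in each multidegree. *)
Record stage_link (S S' : stage) (C : ix S' -> ix S -> k) : Prop := StageLink {
  link_supp : forall p q, C p q != 0 -> insupp (gam p) q;
  link_image : forall d c, @syz S d c <->
    exists2 c' : ix S' -> k, forall p, c' p != 0 -> insupp d p & c = lincomb c' C;
  link_ker : forall d c, @syz S' d c <->
    (forall p, c p != 0 -> insupp d p) /\ forall q, lincomb c C q = 0;
  link_gam : forall p : ix S', exists (q : ix S) s j,
    gam p = (gam q + x (tnth (in_tuple (out s)) j).1)%MM
}.

Lemma insuppP S d (q : ix S) :
  reflect (exists2 u, L u & d = (gam q + u)%MM) (insupp d q).
Proof.
apply: (iffP andP) => [[le Lu]|[u Lu ->]].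
  by exists (d - gam q)%MM => //; rewrite addmC submK.
by rewrite lem_addr addmC addmK.
Qed.

Lemma rank_lex (S : stage) d d' (q q' : ix S) :
  (rank d q < rank d' q')%N =
  (om (d - gam q) + wt q < om (d' - gam q') + wt q')%N
  || (om (d - gam q) + wt q == om (d' - gam q') + wt q')%N && (pos q < pos q')%N.
Proof. by apply: lex_code; exact: leq_bigmax. Qed.

Lemma rank_inj S d : stage_ok S -> injective (@rank S d).
Proof.
move=> ok q q' E; apply: (pos_inj ok).
by apply: lex_code_inj E; exact: leq_bigmax.
Qed.

Lemma lincomb_lin (I J : finType) (C : I -> J -> k) c c' a q :
  lincomb (fun p => c p + a * c' p) C q = lincomb c C q + a * lincomb c' C q.
Proof.
rewrite /lincomb mulr_sumr -big_split /=; apply: eq_bigr => p _.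
by rewrite mulrDl mulrA.
Qed.

Lemma lincomb_delta (I J : finType) (C : I -> J -> k) p q :
  lincomb (fun i => (i == p)%:R) C q = C p q.
Proof.
rewrite /lincomb (bigD1 p) //= eqxx mul1r big1 ?addr0 // => i /negPf ->.
by rewrite mul0r.
Qed.

Lemma addr_neq0 (a b : k) : a + b != 0 -> (a != 0) || (b != 0).
Proof. by apply: contraNT; rewrite negb_or !negbK => /andP[/eqP -> /eqP ->]; rewrite addr0. Qed.

Lemma syz_sum (S : stage) d (I : Type) (r : seq I) (a : I -> k) (h : I -> ix S -> k) c :
  stage_ok S -> syz d c -> (forall q, a q != 0 -> syz d (h q)) ->
  syz d (fun q' => c q' + \sum_(q <- r) a q * h q q').
Proof.
move=> ok sc sh; elim: r => [|q r IH].
  by congr (syz d _): sc; apply: funext => q; rewrite big_nil addr0.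
have [a0|a0] := eqVneq (a q) 0.
  by congr (syz d _): IH; apply: funext => q'; rewrite big_cons a0 mul0r add0r.
have := syz_lin ok (a q) IH (sh _ a0).
by congr (syz d _); apply: funext => q'; rewrite big_cons addrAC addrA.
Qed.

(** Otherwise subtract from [c] the covering syzygies of all its nonreduced terms. The result is
    reduced, hence zero by [syz_free]; but every correction has rank below q, so the coefficient at
    q survives. *)
Lemma lead_in_ideal S d (c : ix S -> k) q : stage_ok S -> syz d c -> c q != 0 ->
  (forall q', c q' != 0 -> q' != q -> (rank d q' < rank d q)%N) ->
  initial_ideal (st q) (d - gam q)%MM.
Proof.
move=> ok sc cq low; apply: contraT => redq.
pose bad q' := c q' != 0 /\ initial_ideal (st q') (d - gam q')%MM.
have hP q' : exists h : ix S -> k, bad q' -> syz d h /\ h q' = 1 /\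
      forall q'', h q'' != 0 -> q'' != q' -> reduced d q'' /\ (rank d q'' < rank d q')%N.
  have [[c0 I0]|nb] := pselect (bad q'); last by exists (fun=> 0).
  by have [h sh hh] := syz_cover ok (syz_supp ok sc c0) I0; exists h.
have [h {}hP] := choice hP.
pose a q' := if initial_ideal (st q') (d - gam q')%MM then - c q' else 0.
have ba q' : a q' != 0 -> bad q'.
  by rewrite /a; case: ifP => [I0|_]; rewrite ?eqxx // oppr_eq0; split.
have s1 := syz_sum (index_enum (ix S)) ok sc (fun q' a0 => (hP q' (ba q' a0)).1).
have := syz_free ok s1 _ q; rewrite big1 => [|q' _].
  rewrite addr0 => H; move/eqP: cq; case; apply: H => q' nz.
  apply/negPn/negP => nred; move/eqP: nz; apply.
  have [I0|nI0] := boolP (initial_ideal (st q') (d - gam q')%MM); last first.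
    rewrite big1 => [|q'' _].
      rewrite addr0; apply/eqP; apply/negPn/negP => c0; case/negP: nred.
      by rewrite /reduced (syz_supp ok sc c0).
    have [->|a0] := eqVneq (a q'') 0; first by rewrite mul0r.
    have [_ [h1 hr]] := hP _ (ba _ a0).
    have [->|h0] := eqVneq (h q'' q') 0; first by rewrite mulr0.
    have [E|ne] := eqVneq q' q''; last by have [] := hr _ h0 ne; rewrite (negPf nred).
    by have [_] := ba _ a0; rewrite -E (negPf nI0).
  (* At a nonreduced place only its own covering syzygy contributes, since the others are reduced
     there. *)
  rewrite (bigD1 q') //= big1 => [|q'' ne].
    have [c0|c0] := eqVneq (c q') 0; first by rewrite /a I0 c0 oppr0 mul0r !addr0.
    have [_ [-> _]] := hP q' (conj c0 I0).
    by rewrite /a I0 mulr1 addr0 subrr.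
  have [->|a0] := eqVneq (a q'') 0; first by rewrite mul0r.
  have [_ [h1 hr]] := hP _ (ba _ a0).
  have [->|h0] := eqVneq (h q'' q') 0; first by rewrite mulr0.
  by have [] := hr q' h0; rewrite 1?eq_sym // (negPf nred).
have [->|a0] := eqVneq (a q') 0; first by rewrite mul0r.
have [c0 I0] := ba _ a0; have [_ [h1 hr]] := hP _ (ba _ a0).
have [->|h0] := eqVneq (h q' q) 0; first by rewrite mulr0.
have ne : q != q' by apply: contraNneq redq => ->.
have [_ lt] := hr _ h0 ne; have := low _ c0; rewrite eq_sym ne => /(_ isT) lt'.
by have := ltn_trans lt lt'; rewrite ltnn.
Qed.

(** * The relations among the chosen syzygies form a stage *)

Section NextStage.
Variables (S : stage) (ok : stage_ok S).

Definition next_ix : finType := {q : ix S & 'I_(size (out (st q)))}.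
Implicit Types (p : next_ix) (q : ix S) (d u : 'X_{1..n}).

Definition label p : G * T := tnth (in_tuple (out (st (tag p)))) (tagged p).
Definition next_gam p : 'X_{1..n} := (gam (tag p) + x (label p).1)%MM.
Definition next_wt p : nat := (wt (tag p) + om (x (label p).1))%N.
(** Together with [next_wt] this gives the Schreyer order: leading terms are compared first, then
    places in the generator list. *)
Definition next_pos p : nat :=
  (pos (tag p) * (\max_(q : ix S) size (out (st q))).+1 + tagged p)%N.

Lemma tagged_bound p : (tagged p <= \max_(q : ix S) size (out (st q)))%N.
Proof. by apply: leq_trans (leq_bigmax (tag p)); exact: ltnW. Qed.

Lemma next_pos_lex p p' : (next_pos p < next_pos p')%N =
  (pos (tag p) < pos (tag p'))%N
  || (pos (tag p) == pos (tag p')) && (tagged p < tagged p')%N.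
Proof. by apply: lex_code; exact: tagged_bound. Qed.

Lemma next_ix_eq p p' : tag p = tag p' -> tagged p = tagged p' :> nat -> p = p'.
Proof.
case: p p' => q j [q' j'] /= Eq; case: _ / Eq j' => j' /val_inj Ej.
by congr (Tagged _ _).
Qed.

Lemma next_pos_inj : injective next_pos.
Proof.
move=> p p' E; have Et := lex_code_inj (tagged_bound p) (tagged_bound p') E.
apply: next_ix_eq => //; apply: (pos_inj ok).
by move: E; rewrite /next_pos Et => /addIn/eqP; rewrite eqn_pmul2r // => /eqP.
Qed.

Variable C : next_ix -> ix S -> k.

Definition next_stage : stage :=
  @Stage next_ix next_gam next_wt (fun p => (label p).2) next_pos
    (fun d c =>
       (forall p, c p != 0 -> (next_gam p <= d)%MM && L (d - next_gam p)%MM)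
       /\ forall q, lincomb c C q = 0).

Hypothesis C_syz : forall p, syz (next_gam p) (C p).
Hypothesis C_tag : forall p, C p (tag p) = 1.
Hypothesis C_low : forall p q, C p q != 0 -> q != tag p ->
  (rank (next_gam p) q < rank (next_gam p) (tag p))%N.

Lemma next_insuppP d p : @insupp next_stage d p ->
  exists2 u, L u & d = (next_gam p + u)%MM.
Proof. by move/insuppP. Qed.

(** Multiplication by a monomial can lower weights by subadditivity, so the leading term of [C p]
    may lose its rank. The bound that it would give without loss still holds for all terms, with
    ties broken as before. *)
Lemma C_weight d p q : @insupp next_stage d p -> C p q != 0 ->
  (om (d - gam q)%MM + wt q <= om (d - next_gam p)%MM + next_wt p)%N /\
  (q != tag p ->
   (om (d - gam q)%MM + wt q = om (d - next_gam p)%MM + next_wt p)%N ->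
   (pos q < pos (tag p))%N).
Proof.
case/next_insuppP=> u Lu -> Cq.
have /insuppP[v Lv Ev] := syz_supp ok (C_syz p) Cq.
have E1 : (next_gam p + u - gam q = u + v)%MM.
  by rewrite Ev -addmA addmC addmK addmC.
have E2 : (next_gam p + u - next_gam p = u)%MM by rewrite addmC addmK.
have E3 : (next_gam p - gam q = v)%MM by rewrite Ev addmC addmK.
have E4 : (next_gam p - gam (tag p) = x (label p).1)%MM.
  by rewrite /next_gam addmC addmK.
rewrite E1 E2.
have [le lt] : (om v + wt q <= next_wt p)%N /\
    (q != tag p -> (om v + wt q = next_wt p)%N -> (pos q < pos (tag p))%N).
  have [Eq|ne] := eqVneq q (tag p); first by rewrite -E3 Eq E4 addnC.
  have := C_low Cq ne; rewrite rank_lex E3 E4 [(_ + wt (tag p))%N]addnC.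
  case/orP=> [lt|/andP[/eqP -> lt]]; split=> // [|_ E]; first exact: ltnW.
  by move: lt; rewrite E ltnn.
have le2 : (om (u + v)%MM + wt q <= om u + (om v + wt q))%N.
  by rewrite addnA leq_add2r omD.
split=> [|ne E]; first by apply: leq_trans le2 _; rewrite leq_add2l.
apply: lt => //; apply/eqP; rewrite eqn_leq le /=.
by rewrite -(leq_add2l (om u)) -E.
Qed.

Lemma C_syz_insupp d p : @insupp next_stage d p -> syz d (C p).
Proof. by case/next_insuppP=> u Lu ->; exact: syz_shift. Qed.

Lemma sub_next_gam d p : @insupp next_stage d p ->
  (d - gam (tag p) = d - next_gam p + x (label p).1)%MM.
Proof.
case/next_insuppP=> u Lu ->; rewrite [X in (X - next_gam p)%MM]addmC addmK.
by rewrite /next_gam -addmA addmC addmK addmC.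
Qed.

(** This is the linear quotient condition: a multiple of p avoids the colon ideal exactly when the
    product loses no weight and no earlier generator divides it. *)
Lemma reduced_next d p : @reduced next_stage d p =
  [&& @insupp next_stage d p,
      (om (d - gam (tag p))%MM + wt (tag p) == om (d - next_gam p)%MM + next_wt p)%N
    & find (leaddiv (d - gam (tag p))%MM) (out (st (tag p))) == tagged p].
Proof.
rewrite /reduced; case: (boolP (@insupp next_stage d p)) => //= sp.
have /next_insuppP[u Lu Ed] := sp.
have Eu : (d - next_gam p = u)%MM by rewrite Ed addmC addmK.
have := linear_quotients (tagged p) Lu; rewrite -/(label p) => /= lq.
have E := sub_next_gam sp; rewrite Eu in E *; rewrite lq -E negb_or -leqNgt.
have le : (om (d - gam (tag p))%MM <= om u + om (x (label p).1))%N by rewrite E omD.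
have -> : (om (d - gam (tag p))%MM + wt (tag p) == om u + next_wt p)%N
          = (om u + om (x (label p).1) <= om (d - gam (tag p))%MM)%N.
  by rewrite /next_wt [(wt _ + _)%N]addnC addnA eqn_add2r eqn_leq le.
case: leqP => //= ge.
have eqom : om (d - gam (tag p))%MM = (om u + om (x (label p).1))%N.
  by apply/eqP; rewrite eqn_leq le.
have jlt := ltn_ord (tagged p).
have lead : leaddiv (d - gam (tag p))%MM (label p).
  by rewrite /leaddiv E lem_addl addmK Lu /= -E eqom.
rewrite has_take_leq; last exact: ltnW.
rewrite -leqNgt eqn_leq.
suff -> : (find (leaddiv (d - gam (tag p))%MM) (out (st (tag p))) <= tagged p)%N by [].
rewrite leqNgt; apply/negP => /(before_find (label p)).
by move: lead; rewrite {1}/label (tnth_nth (label p)) /= => ->.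
Qed.

Lemma reduced_next_low d p q : @reduced next_stage d p -> C p q != 0 ->
  q != tag p -> (rank d q < rank d (tag p))%N.
Proof.
rewrite reduced_next => /and3P[sp /eqP E _] Cq ne.
have [le lt] := C_weight sp Cq; rewrite rank_lex E ltn_neqAle le andbT.
by case: eqVneq => // /(lt ne) ->.
Qed.

(** The division algorithm, by induction on the rank bound. *)
Lemma syz_expand b d c : syz d c -> (forall q, c q != 0 -> (rank d q < b)%N) ->
  exists2 c' : next_ix -> k,
    forall p, c' p != 0 -> @reduced next_stage d p /\ (rank d (tag p) < b)%N
  & c = lincomb c' C.
Proof.
elim: b c => [|b IH] c sc low.
  exists (fun=> 0) => [p|]; first by rewrite eqxx.
  apply: funext => q; rewrite /lincomb big1 => [|p _]; last by rewrite mul0r.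
  by apply/eqP/negPn/negP => /low.
have [q /andP[cq /eqP rq]|no] := pickP (fun q => (c q != 0) && (rank d q == b)).
  have low' q' : c q' != 0 -> q' != q -> (rank d q' < b)%N.
    move=> cq' ne; have := low _ cq'; rewrite ltnS leq_eqVlt -rq => /orP[/eqP|//].
    by move/(rank_inj ok) => E; rewrite E eqxx in ne.
  have I0 := lead_in_ideal ok sc cq.
  rewrite rq in I0; have {}I0 := I0 low'.
  have jlt := I0; rewrite /initial_ideal has_find in jlt.
  (* The index returned by [find] is the first generator dividing the leading term, which makes p
     reduced. *)
  pose p : next_ix := Tagged (fun q => 'I_(size (out (st q)))) (Ordinal jlt).
  have tagp : tag p = q by [].
  have := I0; rewrite /initial_ideal => /(nth_find (label p)).
  have -> : nth (label p) (out (st q)) (find (leaddiv (d - gam q)%MM) (out (st q)))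
            = label p by rewrite {2}/label (tnth_nth (label p)).
  case/and3P=> xle Lsub /eqP Eom.
  have [u0 Lu0 Ed] := insuppP _ _ (syz_supp ok sc cq).
  have Eu0 : (d - gam q = u0)%MM by rewrite Ed addmC addmK.
  have sp : @insupp next_stage d p.
    apply/insuppP; exists (d - gam q - x (label p).1)%MM => //=.
    by rewrite /next_gam tagp -addmA [(x _ + _)%MM]addmC submK // Eu0.
  have Esub : (d - next_gam p = d - gam q - x (label p).1)%MM.
    by rewrite submDA.
  have rp : @reduced next_stage d p.
    rewrite reduced_next sp andTb; apply/andP; split; last exact: eqxx.
    rewrite tagp Esub -Eom /next_wt tagp.
    by rewrite [(wt q + _)%N]addnC addnA eqxx.
  have s1 := syz_lin ok (- c q) sc (C_syz_insupp sp).
  have [q' nz|c' c'P c'E] := IH _ s1.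
    have [Eq|ne] := eqVneq q' q.
      by rewrite Eq -[in C p q]tagp C_tag mulr1 subrr eqxx in nz.
    case/orP: (addr_neq0 nz) => [cq'|]; first exact: low'.
    rewrite mulf_eq0 negb_or => /andP[_ Cq'].
    by rewrite -rq; exact: (reduced_next_low rp Cq' ne).
  exists (fun i => c' i + c q * (i == p)%:R) => [i nz|].
    have [->|ne] := eqVneq i p; first by rewrite tagp rq.
    move: nz; rewrite (negPf ne) mulr0 addr0 => /c'P[ri lti].
    by split=> //; exact: leqW.
  apply: funext => q'; rewrite lincomb_lin lincomb_delta -c'E mulNr.
  by rewrite subrK.
have [q cq|c' c'P c'E] := IH c sc.
  have := low _ cq; rewrite ltnS leq_eqVlt => /orP[rq|//].
  by have := no q; rewrite /= cq rq.
by exists c' => // p /c'P[rp ltp]; split=> //; exact: leqW.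
Qed.

(** A reduced p is determined by its tag, so the leading terms are distinct, and the one of highest
    rank cannot cancel. *)
Lemma next_free d (c : next_ix -> k) :
  (forall q, lincomb c C q = 0) -> (forall p, c p != 0 -> @reduced next_stage d p) ->
  forall p, c p = 0.
Proof.
move=> c0 red p0; apply/eqP/negPn/negP => nz0.
case: (@arg_maxnP _ p0 (fun p => c p != 0) (fun p => rank d (tag p)) nz0).
move=> p nz pmax; have := c0 (tag p); rewrite /lincomb (bigD1 p) //= C_tag mulr1.
rewrite big1 ?addr0 => [|p' ne]; first by move/eqP; rewrite (negPf nz).
have [->|nz'] := eqVneq (c p') 0; first by rewrite mul0r.
have [->|C0] := eqVneq (C p' (tag p)) 0; first by rewrite mulr0.
have [Et|ne'] := eqVneq (tag p) (tag p'); last first.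
  have := reduced_next_low (red _ nz') C0 ne'.
  by rewrite ltnNge; have /= -> := pmax _ nz'.
have tagE i : c i != 0 ->
    tagged i = find (leaddiv (d - gam (tag i))%MM) (out (st (tag i))) :> nat.
  by move/red; rewrite reduced_next => /and3P[_ _ /eqP].
by case/eqP: ne; apply: next_ix_eq; rewrite ?tagE // Et.
Qed.

(** The required relation is p minus the reduced expansion of the multiple of [C p]; the work lies
    in showing that the expansion stays below p. *)
Lemma next_cover d p : @insupp next_stage d p ->
  initial_ideal (label p).2 (d - next_gam p)%MM ->
  exists2 c : next_ix -> k,
    forall p', c p' != 0 -> p' != p ->
      @reduced next_stage d p' /\ (@rank next_stage d p' < @rank next_stage d p)%N
  & c p = 1 /\ forall q, lincomb c C q = 0.
Proof.
move=> sp I0.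
pose W := (om (d - next_gam p)%MM + next_wt p)%N.
(* The successor admits the tie with [tag p] itself, which is settled below by the place in the
   generator list. *)
pose le := (W * (\max_(q : ix S) pos q).+1 + pos (tag p)).+1%N.
have lowP q : (rank d q < le)%N =
    (om (d - gam q)%MM + wt q < W)%N
    || (om (d - gam q)%MM + wt q == W)%N && (pos q <= pos (tag p))%N.
  rewrite ltnS leqNgt /rank lex_code; first by case: ltngtP => //=; rewrite -leqNgt.
    exact: (leq_bigmax (tag p)).
  exact: (leq_bigmax q).
have [q Cq|c' c'P c'E] := @syz_expand le d (C p) (C_syz_insupp sp).
  rewrite lowP; have [] := C_weight sp Cq; rewrite leq_eqVlt -/W.
  case/orP=> [/eqP E|->//]; rewrite E ltnn eqxx /= => lt.
  by have [->//|ne] := eqVneq q (tag p); apply: ltnW; exact: lt.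
have low p' : c' p' != 0 ->
    @reduced next_stage d p' /\ (@rank next_stage d p' < @rank next_stage d p)%N.
  move=> /c'P[rp']; rewrite lowP => lt; split=> //; rewrite rank_lex /= -/W.
  have := rp'; rewrite reduced_next => /and3P[sp' /eqP Ew /eqP Ef].
  rewrite Ew in lt; case/orP: lt => [->//|/andP[/eqP EW lepos]].
  rewrite EW ltnn eqxx /= next_pos_lex ltn_neqAle lepos andbT.
  case: eqVneq => //= /(pos_inj ok) Et.
  have /next_insuppP[u Lu Ed] := sp.
  have Eu : (d - next_gam p = u)%MM by rewrite Ed addmC addmK.
  (* In a full tie no weight was lost, so an earlier generator divides, and the expansion term uses
     the first such one. *)
  have := linear_quotients (tagged p) Lu; rewrite -/(label p) /= -Eu I0 -(sub_next_gam sp) => /esym/orP[].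
    rewrite -(ltn_add2r (wt (tag p))) -{1 2}Et Ew EW -addnA.
    by rewrite [(om (x _) + _)%N]addnC ltnn.
  rewrite has_take_leq; last exact: ltnW.
  by rewrite -Ef Et.
exists (fun i => (i == p)%:R + -1 * c' i) => [p' nz ne|].
  apply: low; move: nz; rewrite (negPf ne) add0r mulf_eq0 negb_or.
  by case/andP.
have c'p : c' p = 0.
  by apply/eqP/negPn/negP => /low[_]; rewrite ltnn.
split=> [|q]; first by rewrite eqxx c'p mulr0 addr0.
by rewrite lincomb_lin lincomb_delta -c'E mulN1r subrr.
Qed.

Lemma next_stage_ok : stage_ok next_stage.
Proof.
split=> [|d c p [sc _] /sc //|d|d c c' a [sc c0] [sc' c0']|d u c Lu [sc c0]|d p|d c [_ c0]].
- exact: next_pos_inj.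
- split=> [p|q]; first by rewrite eqxx.
  by rewrite /lincomb big1 // => p _; rewrite mul0r.
- split=> [p /addr_neq0/orP[/sc//|]|q]; last by rewrite lincomb_lin c0 c0' mulr0 addr0.
  by rewrite mulf_eq0 negb_or => /andP[_ /sc'].
- split=> // p /sc/(@insuppP next_stage d)[v Lv ->]; apply/(@insuppP next_stage).
  by exists (v + u)%MM; [exact: LD | rewrite addmA].
- move=> sp I0; have [c low [cp c0]] := next_cover sp I0; exists c => //.
  split=> // p' nz; have [->//|ne] := eqVneq p' p.
  by have [/andP[]] := low p' nz ne.
- exact: next_free c0.
Qed.

Lemma next_stage_link : @stage_link S next_stage C.
Proof.
split=> [p q Cq|d c|d c|p] //.
- exact: (syz_supp ok (C_syz p) Cq).
- split=> [sc|[c' c'P ->]].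
    have low q : c q != 0 -> (rank d q < (\max_(q : ix S) rank d q).+1)%N.
      by move=> _; rewrite ltnS; exact: (leq_bigmax q).
    have [c' c'P c'E] := syz_expand sc low.
    by exists c' => // p /c'P[/andP[]].
  have sC p : c' p != 0 -> syz d (C p).
    by move=> nz; apply: C_syz_insupp; exact: c'P.
  have := syz_sum (index_enum next_ix) ok (syz0 ok d) sC.
  rewrite (_ : (fun q' => _) = lincomb c' C) //.
  by apply: funext => q; rewrite add0r.
- by exists (tag p), (st (tag p)), (tagged p).
Qed.

End NextStage.

Lemma stage_step S : stage_ok S ->
  exists (S' : stage) (C : ix S' -> ix S -> k), stage_ok S' /\ stage_link C.
Proof.
move=> ok.
have lift (p : next_ix S) : exists c : ix S -> k, [/\ syz (next_gam p) c, c (tag p) = 1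
    & forall q, c q != 0 -> q != tag p -> (rank (next_gam p) q < rank (next_gam p) (tag p))%N].
  have Ex : (next_gam p - gam (tag p) = x (label p).1)%MM.
    by rewrite /next_gam addmC addmK.
  have sp : insupp (next_gam p) (tag p) by apply/insuppP; exists (x (label p).1).
  have [|c sc [c1 low]] := syz_cover ok sp.
    rewrite Ex; apply/(has_nthP (label p)); exists (tagged p) => //.
    rewrite -[nth _ _ _](tnth_nth _ (in_tuple _)) -/(label p).
    have E0 : (x (label p).1 - x (label p).1 = 0)%MM by rewrite -{1}[x _]add0m addmK.
    by rewrite /leaddiv lepm_refl E0 L0 om0 add0n eqxx.
  by exists c; split=> // q cq ne; have [] := low q cq ne.
have [C CP] := choice lift.
exists (next_stage C), C; split.
  by apply: next_stage_ok => // p; have [] := CP p.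
by apply: next_stage_link => // p; have [] := CP p.
Qed.

(** * The first stage: the maximal ideal inside the free module of rank one *)

Variable root : T.
Hypothesis rootP : forall u, L u -> initial_ideal root u = (u != 0%MM).

Definition stage0 : stage :=
  @Stage unit (fun=> 0%MM) (fun=> 0%N) (fun=> root) (fun=> 0%N)
    (fun d c => c tt != 0 -> L d && (d != 0%MM)).

Lemma stage0_ok : stage_ok stage0.
Proof.
split=> [[] []//|d c [] sc /sc /andP[Ld _]|d|d c c' a sc sc'|d u c Lu sc|d []|d c sc red []].
- by rewrite /insupp /= subm0 Ld andbT; apply/mnm_lepP => i; rewrite mnm0E.
- by rewrite /= eqxx.
- by move=> /addr_neq0/orP[/sc//|]; rewrite mulf_eq0 negb_or => /andP[_ /sc'].
- move=> /sc/andP[Ld d0]; rewrite LD //=; apply: contra d0.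
  by rewrite -!mdeg_eq0 mdegD addn_eq0 => /andP[].
- rewrite /insupp /= subm0 => /andP[_ Ld]; rewrite rootP // => d0.
  by exists (fun=> 1) => [_|]; [rewrite Ld | split=> // -[]].
- apply/eqP/negPn/negP => nz; have := red _ nz; have /andP[Ld d0] := sc nz.
  by rewrite /reduced /= subm0 rootP // d0 andbF.
Qed.

End Stages.

(** * The weight and the colon conditions of the pinched Veronese *)

Definition vec : Set := (Z * Z * Z)%type.

Local Open Scope Z_scope.

Definition vadd (u v : vec) : vec :=
  let: (a, b, c) := u in let: (a', b', c') := v in (a + a', b + b', c + c').
Definition vsub (u v : vec) : vec :=
  let: (a, b, c) := u in let: (a', b', c') := v in (a - a', b - b', c - c').

Definition vec0 : vec := (0, 0, 0).

Definition inlat (u : vec) : bool :=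
  let: (a, b, c) := u in
  [&& 0 <=? a, 0 <=? b, 0 <=? c, (a + b + c) mod 3 =? 0
    & ~~ [&& a =? 1, b =? 1 & c =? 1]].

(* The least weight of a factorization of X^u, in closed form. The triangle    *)
(* of cubic monomials is cut into the triangle (X^2Y, Y^2Z, Z^2X), over which  *)
(* the weight only depends on u modulo the lattice spanned by these three, and *)
(* three outer triangles, over which it is linear.                             *)
Definition weight (u : vec) : Z :=
  let: (a, b, c) := u in
  Z.max (Z.max (2 * a - 4 * b - c) ((2 * a - 4 * b - c) mod 9))
    (Z.max (2 * b - 4 * c - a) (2 * c - 4 * a - b)).

Definition gen_vecs : seq vec :=
  [:: (3, 0, 0); (2, 1, 0); (1, 2, 0); (0, 3, 0); (2, 0, 1); (0, 2, 1);
      (1, 0, 2); (0, 1, 2); (0, 0, 3)].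

(* Found by a computer search. In state number s, the pair (g, t) in the s-th  *)
(* list means: the next generator of the ideal is number g, and the colon      *)
(* ideal of the previous ones by it is that of state t.                        *)
Definition automaton : seq (seq (nat * nat)) := (
  [:: [:: (8, 1); (7, 2); (3, 3); (2, 4); (5, 5); (6, 6); (4, 7); (1, 7); (0, 8)];
  [:: (3, 9); (2, 10); (0, 6); (4, 11)];
  [:: (0, 12); (4, 13); (8, 14); (7, 15); (3, 3)];
  [:: (8, 1); (7, 2); (6, 12); (4, 16); (0, 7)];
  [:: (8, 1); (7, 2); (3, 3); (2, 4); (0, 6); (6, 10)];
  [:: (8, 1); (7, 2); (3, 3); (2, 4); (4, 6); (0, 7)];
  [:: (8, 1); (7, 2); (3, 3); (2, 4); (5, 5)];
  [:: (8, 1); (7, 2); (3, 3); (2, 4); (5, 5); (6, 6); (4, 7)];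
  [:: (8, 1); (7, 2); (3, 3); (2, 4); (5, 5); (6, 6); (4, 7); (1, 7)];
  [:: (0, 12); (4, 13); (8, 14); (7, 15)];
  [:: (8, 1); (7, 2); (3, 3); (2, 4); (0, 6)];
  [:: (3, 9); (2, 10); (0, 6); (4, 11); (8, 14); (5, 13)];
  [:: (8, 1); (7, 2); (3, 3); (2, 4)];
  [:: (3, 9); (2, 10); (0, 6); (4, 11); (8, 14)];
  [:: (3, 9); (2, 10); (0, 6); (4, 11); (1, 5)];
  [:: (0, 12); (4, 13); (8, 14); (7, 15); (3, 3); (1, 2)];
  [:: (3, 9); (6, 17); (4, 18); (5, 19); (8, 20); (7, 0)];
  [:: (3, 9)];
  [:: (3, 9); (6, 17); (4, 18); (5, 19); (8, 20)];
  [:: (3, 9); (6, 17); (4, 18); (0, 7)];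
  [:: (3, 9); (6, 17); (4, 18); (5, 19); (1, 16); (2, 0); (0, 8)]])%N.

Definition leads (u : vec) : bitseq :=
  [seq inlat (vsub u a) && (weight (vsub u a) + weight a =? weight u) | a <- gen_vecs].

(* All the data that the colon conditions at u depend on. *)
Definition profile (u : vec) : bitseq * seq (bool * bitseq) :=
  (leads u, [seq (weight (vadd u a) <? weight u + weight a, leads (vadd u a)) | a <- gen_vecs]).

Definition some_lead (D : bitseq) (s : seq (nat * nat)) : bool :=
  has (fun e => nth false D e.1) s.

Definition profile_ok (p : bitseq * seq (bool * bitseq)) : bool :=
  all (fun s => all (fun j =>
      let e := nth (0, 0)%N s j in
      let q := nth (false, [::]) p.2 e.1 in
      some_lead p.1 (nth [::] automaton e.2) == q.1 || some_lead q.2 (take j s))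
    (iota 0 (size s))) automaton.

Definition origin (u : vec) : bool := let: (a, b, c) := u in [&& a =? 0, b =? 0 & c =? 0].

Definition vec_ok (u : vec) : bool :=
  profile_ok (profile u) && (origin u (+) some_lead (leads u) (nth [::] automaton 0)).

(* Subtracting one of X^2Y, Y^2Z, Z^2X, X^3, Y^3, Z^3 does not change the      *)
(* profile of such u.                                                          *)
Definition reducible (u : vec) : bool :=
  let: (a, b, c) := u in
  [|| [&& 2 * c - 4 * a - b <=? -22, 7 <=? a & 4 <=? b],
      [&& 2 * a - 4 * b - c <=? -22, 7 <=? b & 4 <=? c],
      [&& 2 * b - 4 * c - a <=? -22, 7 <=? c & 4 <=? a],
      27 <=? 2 * a - 4 * b - c, 27 <=? 2 * b - 4 * c - a | 27 <=? 2 * c - 4 * a - b].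

(** * Periodicity of the weight and the finite check *)

Ltac Zify.zify_post_hook ::= Z.to_euclidean_division_equations.

(** The three linear forms in the weight add up to -3 times [a + b + c], so for a large sum one of
    them is very negative; the rest is linear arithmetic. *)
Lemma irreducible_bound u : inlat u -> ~~ reducible u ->
  let: (a, b, c) := u in a + b + c <= 33.
Proof. case: u => [[a b] c]; rewrite /inlat /reducible; lia. Qed.

Definition level (u : vec) : Z := let: (a, b, c) := u in a + b + c.

Lemma irreducible_check : let r := iota 0 34 in
  all (fun i => all (fun j => all (fun l =>
    let u := (Z.of_nat i, Z.of_nat j, Z.of_nat l) in
    if inlat u && ~~ reducible u then vec_ok u else true) r) r) r.
Proof. by vm_compute. Qed.

Lemma irreducible_ok u : inlat u -> ~~ reducible u -> vec_ok u.
Proof.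
move=> lu irr; have := irreducible_bound lu irr.
case: u lu irr => [[a b] c] lu irr le.
have [a0 b0 c0] : [/\ 0 <= a, 0 <= b & 0 <= c].
  by move: lu; rewrite /inlat; split; lia.
have /allP/(_ (Z.to_nat a)) := irreducible_check; rewrite mem_iota => /(_ ltac:(lia)).
move=> /allP/(_ (Z.to_nat b)); rewrite mem_iota => /(_ ltac:(lia)).
move=> /allP/(_ (Z.to_nat c)); rewrite mem_iota => /(_ ltac:(lia)).
by cbv zeta; rewrite !Z2Nat.id // lu irr.
Qed.

Definition stable (g v : vec) : Prop :=
  inlat v = inlat (vsub v g) /\ (inlat v -> weight v = weight (vsub v g) + weight g).

Definition rot (u : vec) : vec := let: (a, b, c) := u in (c, a, b).

Lemma inlat_rot u : inlat (rot u) = inlat u.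
Proof. case: u => [[a b] c]; rewrite /inlat /=; lia. Qed.

(** Rotation permutes the three linear forms, which are congruent modulo 9 when 3 divides the level,
    so the residue term is unchanged too. *)
Lemma weight_rot u : level u mod 3 = 0 -> weight (rot u) = weight u.
Proof.
case: u => [[a b] c]; rewrite /level /rot /weight => s3.
have [t st] : exists t, c = 3 * t - a - b by exists ((a + b + c) / 3); lia.
have -> : 2 * c - 4 * a - b = 2 * a - 4 * b - c + (t - a) * 9 by lia.
have -> : 2 * b - 4 * c - a = 2 * a - 4 * b - c + (2 * t - a - c) * 9 by lia.
by rewrite Z_mod_plus_full; lia.
Qed.

Lemma inlat_level u : inlat u -> level u mod 3 = 0.
Proof. case: u => [[a b] c]; rewrite /inlat /level; lia. Qed.

Lemma stable_rot g v : level g mod 3 = 0 -> stable g v -> stable (rot g) (rot v).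
Proof.
have Er : vsub (rot v) (rot g) = rot (vsub v g).
  by case: v g => [[a b] c] [[a' b'] c'].
move=> g3 [E W]; split; rewrite Er !inlat_rot // => lv.
have lv' := lv; rewrite E in lv'.
rewrite (weight_rot (inlat_level lv)) (weight_rot (inlat_level lv')) (weight_rot g3).
exact: W.
Qed.

(** Subtracting (2, 1, 0) fixes two of the forms and raises the third by 9, to at most 8. Being
    congruent to the residue modulo 9, it still does not exceed it. *)
Lemma stable_edge a b c : (a + b + c) mod 3 = 0 -> 4 <= a -> 1 <= b ->
  2 * c - 4 * a - b <= -1 -> stable (2, 1, 0) (a, b, c).
Proof.
move=> s3 la lb le; split; first by rewrite /inlat /=; lia.
move=> _; have [t st] : exists t, c = 3 * t - a - b.
  by exists ((a + b + c) / 3); lia.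
rewrite /weight /vsub.
have -> : 2 * (a - 2) - 4 * (b - 1) - (c - 0) = 2 * a - 4 * b - c by lia.
have -> : 2 * (b - 1) - 4 * (c - 0) - (a - 2) = 2 * b - 4 * c - a by lia.
have : 2 * c - 4 * a - b = 2 * a - 4 * b - c + 9 * (t - a) by lia.
have -> : Z.max (Z.max (2 * 2 - 4 * 1 - 0) ((2 * 2 - 4 * 1 - 0) mod 9))
   (Z.max (2 * 1 - 4 * 0 - 2) (2 * 0 - 4 * 2 - 1)) = 0 by [].
lia.
Qed.

(** The first form drops by 6 and remains nonnegative, so it is the maximum before and after. *)
Lemma stable_corner a b c : 6 <= 2 * a - 4 * b - c -> stable (3, 0, 0) (a, b, c).
Proof.
move=> le; split; first by rewrite /inlat /=; lia.
rewrite /inlat /weight /vsub => lat.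
have [b0 c0] : 0 <= b /\ 0 <= c by lia.
have -> : Z.max (Z.max (2 * 3 - 4 * 0 - 0) ((2 * 3 - 4 * 0 - 0) mod 9))
   (Z.max (2 * 0 - 4 * 0 - 3) (2 * 0 - 4 * 3 - 0)) = 6 by [].
have := Z.mod_le (2 * a - 4 * b - c) 9; have := Z.mod_le (2 * (a - 3) - 4 * (b - 0) - (c - 0)) 9.
move: (_ mod _) (_ mod _) => r r'; lia.
Qed.

(* Contains all the shifts that occur in a profile.                            *)
Definition mild (d : vec) : bool :=
  let: (a, b, c) := d in
  [&& -3 <=? a, a <=? 3, -3 <=? b, b <=? 3, -3 <=? c, c <=? 3 & (a + b + c) mod 3 =? 0].

(** A mild shift moves each form by at most 2 * 3 + 4 * 3 + 3 = 21 and each coordinate by at most 3,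
    so the thresholds -22, 27, 7 and 4 become the -1, 6, 4 and 1 of [stable_edge] and
    [stable_corner]. Rotation supplies the other cases. *)
Lemma reducible_stable u : inlat u -> reducible u ->
  exists2 g, level g = 3 & forall d, mild d -> stable g (vadd u d).
Proof.
case: u => [[a b] c]; rewrite /inlat /reducible /mild => lu.
have s3 : (a + b + c) mod 3 = 0 by lia.
have edge a' b' c' := @stable_rot (2, 1, 0) (a', b', c') erefl.
have corner a' b' c' := @stable_rot (3, 0, 0) (a', b', c') erefl.
case/or4P=> [r|r|r|/or3P[r|r|r]].
- by exists (2, 1, 0) => // -[[p q] s] md; apply: stable_edge; lia.
- exists (0, 2, 1) => // -[[p q] s] md.
  by apply: (edge (b + q) (c + s) (a + p)); apply: stable_edge; lia.
- exists (1, 0, 2) => // -[[p q] s] md.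
  apply: (@stable_rot (0, 2, 1) (b + q, c + s, a + p) erefl).
  by apply: (edge (c + s) (a + p) (b + q)); apply: stable_edge; lia.
- by exists (3, 0, 0) => // -[[p q] s] md; apply: stable_corner; lia.
- exists (0, 3, 0) => // -[[p q] s] md.
  by apply: (corner (b + q) (c + s) (a + p)); apply: stable_corner; lia.
- exists (0, 0, 3) => // -[[p q] s] md.
  apply: (@stable_rot (0, 3, 0) (b + q, c + s, a + p) erefl).
  by apply: (corner (c + s) (a + p) (b + q)); apply: stable_corner; lia.
Qed.

Lemma vadd0 u : vadd u vec0 = u.
Proof. by case: u => [[a b] c]; rewrite /vadd /vec0 !Z.add_0_r. Qed.

Lemma leads_stable g v : inlat v -> stable g v ->
  (forall a, a \in iota 0 9 -> stable g (vsub v (nth vec0 gen_vecs a))) ->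
  leads v = leads (vsub v g).
Proof.
move=> lv [Ev Wv] st; apply: (@eq_from_nth _ false); rewrite !size_map // => i lti.
rewrite !(nth_map vec0) //; set a := nth _ _ i.
have [El Wl] : stable g (vsub v a) by apply: st; rewrite mem_iota.
have E : vsub (vsub v g) a = vsub (vsub v a) g.
  case: v g a {lv Ev Wv st El Wl} => [[? ?] ?] [[? ?] ?] [[? ?] ?] /=.
  by congr (_, _, _); lia.
rewrite E -El; case: (boolP (inlat _)) => //= /Wl ->; rewrite Wv //; lia.
Qed.

Lemma inlat_add u v : inlat u -> inlat v -> inlat (vadd u v).
Proof. case: u v => [[a b] c] [[a' b'] c']; rewrite /inlat /vadd; lia. Qed.

(** Linear forms and the residue modulo 9 are subadditive, and so is their maximum. *)
Lemma weight_add u v : inlat u -> inlat v -> weight (vadd u v) <= weight u + weight v.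
Proof.
case: u v => [[a b] c] [[a' b'] c'] _ _; rewrite /weight /vadd.
have := Z.add_mod (2 * a - 4 * b - c) (2 * a' - 4 * b' - c') 9.
have := Z.mod_le ((2 * a - 4 * b - c) mod 9 + (2 * a' - 4 * b' - c') mod 9) 9.
have -> : 2 * (a + a') - 4 * (b + b') - (c + c')
  = 2 * a - 4 * b - c + (2 * a' - 4 * b' - c') by lia.
lia.
Qed.

Lemma inlat_gen i : (i < 9)%N -> inlat (nth vec0 gen_vecs i).
Proof. by move: i; do 9?[case=> //]. Qed.

Lemma mild_gen i j : (i < 9)%N -> (j < 9)%N ->
  let a := nth vec0 gen_vecs i in let b := nth vec0 gen_vecs j in
  [/\ mild a, mild (vsub vec0 a) & mild (vsub a b)].
Proof. by move: i j; do 9?[case=> [|] //]; do 9?[case=> [|] //]. Qed.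

Lemma profile_nth u i : (i < 9)%N -> let a := nth vec0 gen_vecs i in
  let q := nth (false, [::]) (profile u).2 i in
  q.1 = (weight (vadd u a) <? weight u + weight a) /\ q.2 = leads (vadd u a).
Proof. by move=> lti; rewrite (nth_map vec0). Qed.

Lemma profile_stable g u : inlat u -> (forall d, mild d -> stable g (vadd u d)) ->
  profile u = profile (vsub u g).
Proof.
move=> lu st.
have st0 : stable g u by rewrite -[u]vadd0; exact: st.
congr (_, _).
  apply: leads_stable => // i; rewrite mem_iota /= => lti.
  have [_ mi _] := mild_gen lti lti; have := st _ mi.
  by congr (stable _ _); case: u {lu st st0} => [[? ?] ?]; case: nth => [[? ?] ?].
apply: (@eq_from_nth _ (false, [::])); rewrite !size_map // => i lti.
rewrite !(nth_map vec0) //; set a := nth _ _ i.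
have la : inlat a by exact: inlat_gen.
have sta : stable g (vadd u a) by apply: st; have [] := mild_gen lti lti.
have E : vadd (vsub u g) a = vsub (vadd u a) g.
  case: u g a {lu st st0 la sta} => [[? ?] ?] [[? ?] ?] [[? ?] ?] /=.
  by congr (_, _, _); lia.
have lua := inlat_add lu la.
rewrite E -leads_stable //; last first.
  move=> j; rewrite mem_iota /= => ltj; have [_ _ mij] := mild_gen lti ltj.
  have := st _ mij; congr (stable _ _); rewrite -/a.
  case: u a {lu st st0 la sta E lua mij} => [[? ?] ?] [[? ?] ?].
  by case: nth => [[? ?] ?] /=; congr (_, _, _); lia.
by congr (_, _); have := sta.2 lua; have := st0.2 lu; lia.
Qed.

(** Descent on the level: a reducible u has the profile of [vsub u g], and neither of the two is the
    origin. *)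
Lemma inlat_vec_ok u : inlat u -> vec_ok u.
Proof.
have [n] : exists n, (level u <= Z.of_nat n) by exists (Z.to_nat (level u)); lia.
elim: n u => [|n IH] u le lu; have [red|irr] := boolP (reducible u);
    try exact: irreducible_ok.
  by case: u le lu red => [[a b] c]; rewrite /level /inlat /reducible; lia.
have [g g3 st] := reducible_stable lu red; have E := profile_stable lu st.
have st0 : stable g u by rewrite -[u]vadd0; exact: st.
have lv : inlat (vsub u g) by rewrite -st0.1.
have Elv : level (vsub u g) = level u - 3.
  by rewrite -g3; case: u g {le lu red st E st0 lv g3} => [[? ?] ?] [[? ?] ?] /=; lia.
have := IH (vsub u g); rewrite Elv lv /vec_ok -E => /(_ _ isT).
have -> : leads (vsub u g) = leads u.
  by rewrite -[LHS]/(profile (vsub u g)).1 -E.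
have -> : origin (vsub u g) = origin u; last by apply; lia.
move: red lu Elv lv; case: u {le st E st0} => [[a b] c]; case: (vsub _ _) => [[a' b'] c'].
by rewrite /reducible /inlat /level /origin; lia.
Qed.

Lemma weight_ge0 u : 0 <= weight u.
Proof.
case: u => [[a b] c]; rewrite /weight.
by have := Z.mod_pos_bound (2 * a - 4 * b - c) 9; lia.
Qed.

Local Close Scope Z_scope.

(** * Transfer from integer vectors to monomial exponents *)

Definition vec_of (m : 'X_{1..3}) : vec :=
  (Z.of_nat (m (@Ordinal 3 0 isT)), Z.of_nat (m (@Ordinal 3 1 isT)),
   Z.of_nat (m (@Ordinal 3 2 isT))).

Definition mnm_of (u : vec) : 'X_{1..3} :=
  let: (a, b, c) := u in
  [multinom nth 0%N [:: Z.to_nat a; Z.to_nat b; Z.to_nat c] i | i < 3].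

Definition pv_lat (m : 'X_{1..3}) : bool := inlat (vec_of m).
Definition pv_weight (m : 'X_{1..3}) : nat := Z.to_nat (weight (vec_of m)).
Definition pv_gen (i : nat) : 'X_{1..3} := mnm_of (nth vec0 gen_vecs i).
Definition pv_out (s : nat) : seq (nat * nat) := nth [::] automaton s.

Lemma vec_of_inj : injective vec_of.
Proof.
move=> m m' [/Nat2Z.inj E0 /Nat2Z.inj E1 /Nat2Z.inj E2]; apply/mnmP => i.
case: i => [[|[|[|//]]] lti].
- by rewrite (_ : Ordinal lti = @Ordinal 3 0 isT) //; exact: val_inj.
- by rewrite (_ : Ordinal lti = @Ordinal 3 1 isT) //; exact: val_inj.
- by rewrite (_ : Ordinal lti = @Ordinal 3 2 isT) //; exact: val_inj.
Qed.

Lemma vec_of0 : vec_of 0%MM = vec0.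
Proof. by rewrite /vec_of !mnm0E. Qed.

Lemma vec_ofD m m' : vec_of (m + m')%MM = vadd (vec_of m) (vec_of m').
Proof. by rewrite /vec_of !mnmDE /= !Nat2Z.inj_add. Qed.

Lemma mnm_ofK u : inlat u -> vec_of (mnm_of u) = u.
Proof.
case: u => [[a b] c]; rewrite /vec_of !mnmE /= /inlat => lu.
by congr (_, _, _); lia.
Qed.

Lemma inlat_gen_default i : inlat (nth vec0 gen_vecs i).
Proof.
by have [lt|ge] := ltnP i 9; [exact: inlat_gen | rewrite nth_default].
Qed.

Lemma vec_of_gen i : vec_of (pv_gen i) = nth vec0 gen_vecs i.
Proof. by rewrite mnm_ofK // inlat_gen_default. Qed.

Lemma mnm_le_vec (m u : 'X_{1..3}) :
  (m <= u)%MM && pv_lat (u - m)%MM = inlat (vsub (vec_of u) (vec_of m)).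
Proof.
have [le|nle] := boolP (m <= u)%MM.
  rewrite andTb /pv_lat; congr (inlat _); rewrite -{2}(submK le) vec_ofD.
  case: (vec_of (u - m)) (vec_of m) => [[a b] c] [[a' b'] c'] /=.
  by congr (_, _, _); lia.
symmetry; apply: contraNF nle => lat; apply/mnm_lepP => i.
move: lat; rewrite /inlat /vec_of /vsub => lat.
case: i => [[|[|[|//]]] lti].
- by rewrite (_ : Ordinal lti = @Ordinal 3 0 isT); [lia | exact: val_inj].
- by rewrite (_ : Ordinal lti = @Ordinal 3 1 isT); [lia | exact: val_inj].
- by rewrite (_ : Ordinal lti = @Ordinal 3 2 isT); [lia | exact: val_inj].
Qed.

Lemma pv_lat0 : pv_lat 0%MM. Proof. by rewrite /pv_lat vec_of0. Qed.

Lemma pv_latD u v : pv_lat u -> pv_lat v -> pv_lat (u + v)%MM.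
Proof. by rewrite /pv_lat vec_ofD; exact: inlat_add. Qed.

Lemma pv_lat_gen i : pv_lat (pv_gen i).
Proof. by rewrite /pv_lat vec_of_gen inlat_gen_default. Qed.

Lemma pv_weight0 : pv_weight 0%MM = 0%N.
Proof. by rewrite /pv_weight vec_of0. Qed.

Lemma pv_weightD u v : pv_lat u -> pv_lat v ->
  (pv_weight (u + v)%MM <= pv_weight u + pv_weight v)%N.
Proof.
move=> lu lv; have := weight_add lu lv; rewrite /pv_weight vec_ofD.
by have := @weight_ge0 (vec_of u); have := @weight_ge0 (vec_of v); lia.
Qed.

Lemma pv_leaddiv u (e : nat * nat) : (e.1 < 9)%N ->
  leaddiv pv_lat pv_weight pv_gen u e = nth false (leads (vec_of u)) e.1.
Proof.
move=> lt; rewrite /leaddiv andbA mnm_le_vec (nth_map vec0) // -vec_of_gen.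
have [lat|//] := boolP (inlat _); have := lat; rewrite -mnm_le_vec => /andP[le _].
have -> : vsub (vec_of u) (vec_of (pv_gen e.1)) = vec_of (u - pv_gen e.1)%MM.
  rewrite -{1}(submK le) vec_ofD.
  case: (vec_of _) (vec_of _) => [[a b] c] [[a' b'] c'] /=.
  by congr (_, _, _); lia.
rewrite /pv_weight; move: (@weight_ge0 (vec_of u)) (@weight_ge0 (vec_of (pv_gen e.1)))
  (@weight_ge0 (vec_of (u - pv_gen e.1)%MM)).
by move: (weight _) (weight _) (weight _) => w1 w2 w3 *; lia.
Qed.

Lemma automaton_gens s : all (fun e => (e.1 < 9)%N) (pv_out s).
Proof.
have [lt|ge] := ltnP s (size automaton); last by rewrite /pv_out nth_default.
have : all (all (fun e => (e.1 < 9)%N)) automaton by [].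
by move/allP; apply; exact: mem_nth.
Qed.

Lemma pv_initial_ideal s u :
  initial_ideal pv_lat pv_weight pv_gen pv_out s u
  = some_lead (leads (vec_of u)) (pv_out s).
Proof.
by apply: eq_in_has => e /(allP (automaton_gens s)); exact: pv_leaddiv.
Qed.

Lemma pv_linear_quotients s (j : 'I_(size (pv_out s))) u : pv_lat u ->
  let e := tnth (in_tuple (pv_out s)) j in
  initial_ideal pv_lat pv_weight pv_gen pv_out e.2 u =
  (pv_weight (u + pv_gen e.1)%MM < pv_weight u + pv_weight (pv_gen e.1))%N
  || has (leaddiv pv_lat pv_weight pv_gen (u + pv_gen e.1)%MM) (take j (pv_out s)).
Proof.
move=> lu; rewrite (tnth_nth (0, 0)%N) /=; set e := nth _ _ _.
have ltj := ltn_ord j.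
have e9 : (e.1 < 9)%N by apply: (allP (automaton_gens s)); exact: mem_nth.
have lts : (s < size automaton)%N.
  rewrite ltnNge; apply/negP => ge.
  have s0 : size (pv_out s) = 0%N by rewrite /pv_out nth_default.
  by move: ltj; rewrite [X in (_ < X)%N]s0.
have /andP[/allP/(_ _ (mem_nth [::] lts))/allP/(_ j)] := inlat_vec_ok lu.
rewrite mem_iota leq0n add0n andTb => /(_ ltj)/eqP + _; rewrite -/(pv_out s) -/e.
rewrite pv_initial_ideal -/(pv_out _) => ->.
have [-> ->] := profile_nth (vec_of u) e9; rewrite -vec_of_gen -vec_ofD; congr (_ || _).
  rewrite /pv_weight; move: (@weight_ge0 (vec_of u)) (@weight_ge0 (vec_of (pv_gen e.1)))
    (@weight_ge0 (vec_of (u + pv_gen e.1)%MM)).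
  by move: (weight _) (weight _) (weight _) => w1 w2 w3 *; lia.
apply: eq_in_has => f /mem_take/(allP (automaton_gens s)) f9.
by rewrite pv_leaddiv.
Qed.

Lemma pv_root u : pv_lat u ->
  initial_ideal pv_lat pv_weight pv_gen pv_out 0%N u = (u != 0%MM).
Proof.
move=> lu; rewrite pv_initial_ideal; have /andP[_] := inlat_vec_ok lu.
have -> : origin (vec_of u) = (u == 0%MM).
  apply/idP/eqP => [|->]; last by rewrite vec_of0.
  move=> u0; apply: vec_of_inj; rewrite vec_of0; move: u0.
  by rewrite /origin /vec_of /vec0 => u0; congr (_, _, _); lia.
by rewrite -/(pv_out 0); case: (_ == _); case: some_lead.
Qed.

(** * Multigraded components *)

Lemma big_pred1_uniq (V : nmodType) (I : eqType) (r : seq I) (d : I) (F : I -> V) :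
  uniq r -> \sum_(i <- r | i == d) F i = if d \in r then F d else 0.
Proof.
move=> ur; case: ifP => [dr|ndr].
  by rewrite -big_filter filter_pred1_uniq // big_seq1.
by rewrite big1_seq // => i /andP[/eqP -> dr]; rewrite dr in ndr.
Qed.

Lemma level_vec_of m : level (vec_of m) = Z.of_nat (mdeg m).
Proof.
have -> : mdeg m = (m (@Ordinal 3 0 isT) + m (@Ordinal 3 1 isT) + m (@Ordinal 3 2 isT))%N.
  rewrite mdegE !big_ord_recl big_ord0 addn0 addnA.
  by congr (m _ + m _ + m _)%N; exact: val_inj.
rewrite /level /vec_of; lia.
Qed.

Lemma mdeg_pv_gen i : (i < 9)%N -> mdeg (pv_gen i) = 3.
Proof.
move=> lti; apply: Nat2Z.inj; rewrite -level_vec_of vec_of_gen.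
by move: i lti; do 9?[case=> [|] //].
Qed.

Lemma mdeg_pv_lat m : pv_lat m -> exists n, mdeg m = (3 * n)%N.
Proof.
move=> /inlat_level; rewrite level_vec_of => m3.
by exists (Z.to_nat (Z.of_nat (mdeg m) / 3)); lia.
Qed.

Section PinchedVeroneseStages.
Variable k : fieldType.
Implicit Types (m d : 'X_{1..3}) (f : pv_type k).

Lemma pv_gensE (i : 'I_9) : tnth (pv_gens k) i = 'X_[pv_gen i].
Proof.
have XE m : 'X_[m] = varX k ^+ m (@Ordinal 3 0 isT) * varY k ^+ m (@Ordinal 3 1 isT)
                     * varZ k ^+ m (@Ordinal 3 2 isT).
  rewrite mpolyXE_id !big_ord_recl big_ord0 mulr1 mulrA /varX /varY /varZ.
  by congr ('X_ _ ^+ m _ * 'X_ _ ^+ m _ * 'X_ _ ^+ m _); exact: val_inj.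
rewrite XE (tnth_nth 0) /pv_gen; case: i => i lti /=; move: i lti.
by do 9?[case=> [_|]; first by
  rewrite /= !mnmE -/(varX k) -/(varY k) -/(varZ k) ?expr0 ?mulr1 ?mul1r ?expr1].
Qed.

(** By [pv_root] some generator splits off any nonzero exponent of the lattice, with quotient again
    in the lattice. *)
Lemma pv_lat_monomial n m : pv_lat m -> mdeg m = (3 * n)%N ->
  exists2 q : {mpoly k[9]}, q \is n.-homog & 'X_[m] = q \mPo pv_gens k.
Proof.
elim: n m => [|n IH] m lm dm.
  exists 1; first exact: dhomog1.
  by move/eqP: dm; rewrite mdeg_eq0 => /eqP ->; rewrite mpolyX0 rmorph1.
have : m != 0%MM by rewrite -mdeg_eq0 dm.
rewrite -pv_root // => /hasP[e /(allP (automaton_gens 0)) e9 /and3P[le lsub _]].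
have [|q qh qE] := IH _ lsub.
  have := mdeg_pv_gen e9; have := congr1 mdeg (submK le).
  by rewrite mdegD dm; lia.
exists (q * 'X_(Ordinal e9)).
  by have := dhomogM qh (dhomogXi k (Ordinal e9)); rewrite addn1.
rewrite rmorphM /= comp_mpolyXU -qE -(tnth_nth 0 _ (Ordinal e9)) pv_gensE /=.
by rewrite -mpolyXD submK.
Qed.

Definition mon m : pv_type k := insubd 0 'X_[m].

Lemma pv_val_mon m : pv_lat m -> pv_val (mon m) = 'X_[m].
Proof.
move=> lm; have [n dm] := mdeg_pv_lat lm; have [q _ qE] := pv_lat_monomial lm dm.
by rewrite insubdK //; apply/pv_predP; exists q.
Qed.

Lemma mon_gpart n m : pv_lat m -> mdeg m = (3 * n)%N -> pv_gpart n (mon m).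
Proof.
move=> lm dm; have [q qh qE] := pv_lat_monomial lm dm; exists q => //.
by apply: val_inj; rewrite /= [LHS]pv_val_mon.
Qed.

Lemma monD m m' : pv_lat m -> pv_lat m' -> mon m * mon m' = mon (m + m')%MM.
Proof.
move=> lm lm'; apply: val_inj; transitivity (pv_val (mon m) * pv_val (mon m')) => //.
by rewrite !pv_val_mon // -mpolyXD -pv_val_mon // pv_latD.
Qed.

Lemma pv_support f m : (pv_val f)@_m != 0 -> pv_lat m.
Proof.
rewrite -mcoeff_msupp; have [q ->] := pv_evalP f; rewrite /= comp_mpolyE.
pose P (p : {mpoly k[3]}) := forall m, m \in msupp p -> pv_lat m.
have PM p p' : P p -> P p' -> P (p * p').
  move=> Pp Pp' m' /msuppM_le/allpairsP[[m1 m2] /= [m1p m2p ->]].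
  by apply: pv_latD; [exact: Pp | exact: Pp'].
have P1 : P 1 by move=> m'; rewrite msupp1 inE => /eqP ->; exact: pv_lat0.
suff : P (\sum_(m <- msupp q) q@_m *: \prod_(i < 9) tnth (pv_gens k) i ^+ m i) by apply.
apply: (big_ind P) => [m'|p p' Pp Pp' m' /msuppD_le|m1 _ m' /msuppZ_le].
- by rewrite msupp0.
- by rewrite mem_cat => /orP[/Pp|/Pp'].
move: m'; apply: (big_ind P) => // i _; elim: (m1 i) => [|j IH] //.
rewrite exprS; apply: PM IH => m'; rewrite pv_gensE msuppX inE => /eqP ->.
exact: pv_lat_gen.
Qed.

Section Components.
Variable S : stage k 3 nat.

Definition component d (v : ix S -> pv_type k) : ix S -> k :=
  fun q => if (gam q <= d)%MM then (pv_val (v q))@_(d - gam q) else 0.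

Definition embed d (c : ix S -> k) : ix S -> pv_type k :=
  fun q => c q *: mon (d - gam q)%MM.

Definition degrees (v : ix S -> pv_type k) : seq 'X_{1..3} :=
  undup (flatten [seq [seq (gam q + m)%MM | m <- msupp (pv_val (v q))] | q <- enum (ix S)]).

Lemma component_supp d v q : component d v q != 0 -> insupp pv_lat d q.
Proof.
by rewrite /component /insupp; case: ifP => [_ /pv_support|]; rewrite ?eqxx.
Qed.

Lemma component_degrees d v q : component d v q != 0 -> d \in degrees v.
Proof.
rewrite /component; case: ifP => [le|]; rewrite ?eqxx // => nz.
rewrite mem_undup; apply/flatten_mapP; exists q; first by rewrite mem_enum.
by apply/mapP; exists (d - gam q)%MM; rewrite ?mcoeff_msupp // addmC submK.
Qed.

Lemma component_embed d d' c : (forall q, c q != 0 -> insupp pv_lat d q) ->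
  component d' (embed d c) = fun q => if d == d' then c q else 0.
Proof.
move=> sc; apply: funext => q; rewrite /component /embed.
have [->|nz] := eqVneq (c q) 0; first by rewrite scale0r mcoeff0 !if_same.
have /andP[le lsub] := sc q nz; rewrite pv_valZ mcoeffZ pv_val_mon // mcoeffX.
have [<-|ne] := eqVneq d d'; first by rewrite le eqxx mulr1.
case: ifP => // le'; case: eqVneq => [E|]; last by rewrite mulr0.
by case/eqP: ne; rewrite -(submK le) -(submK le') E.
Qed.

Lemma component_sum d (I : Type) (r : seq I) (F : I -> ix S -> pv_type k) :
  component d (fun q => \sum_(i <- r) F i q) = fun q => \sum_(i <- r) component d (F i) q.
Proof.
apply: funext => q; rewrite /component; case: ifP => _; last by rewrite big1_eq.
by rewrite pv_val_sum raddf_sum.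
Qed.

Lemma component_inj v v' : (forall d, component d v = component d v') -> v = v'.
Proof.
move=> E; apply: funext => q; apply: val_inj; apply/mpolyP => m.
have := congr1 (fun c => c q) (E (gam q + m)%MM).
by rewrite /component lem_addr addmC addmK.
Qed.

Lemma embed_component v : v = fun q => \sum_(d <- degrees v) embed d (component d v) q.
Proof.
apply: component_inj => d; rewrite component_sum; apply: funext => q.
transitivity (\sum_(d' <- degrees v | d' == d) component d v q); last first.
  rewrite big_mkcond; apply: eq_bigr => d' _.
  rewrite component_embed; last by move=> q' /component_supp.
  by have [->|] := eqVneq d' d.
rewrite big_pred1_uniq ?undup_uniq //; case: ifP => // ndv.
by apply/eqP/negPn; apply: contraFN ndv; exact: component_degrees.
Qed.

End Components.

Variables (S S' : stage k 3 nat) (C : ix S' -> ix S -> k).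
Hypothesis SC : stage_link pv_lat pv_gen pv_out C.

Definition diff_entry (p : ix S') (q : ix S) : pv_type k :=
  C p q *: mon (gam p - gam q)%MM.

Definition apply_diff (v : ix S' -> pv_type k) : ix S -> pv_type k :=
  fun q => \sum_p v p * diff_entry p q.

(** Within one multidegree the monomials are forced, so the differential acts on coefficients as the
    scalar matrix [C]. *)
Lemma apply_diff_embed d c : (forall p, c p != 0 -> insupp pv_lat d p) ->
  apply_diff (embed d c) = embed d (lincomb c C).
Proof.
move=> sc; apply: funext => q; rewrite /apply_diff /embed /lincomb scaler_suml.
apply: eq_bigr => p _; rewrite /diff_entry -scalerAl -scalerAr scalerA.
have [->|c0] := eqVneq (c p) 0; first by rewrite !mul0r !scale0r.
have [->|C0] := eqVneq (C p q) 0; first by rewrite !mulr0 !scale0r.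
have /andP[le lsub] := sc p c0; have /andP[le' lsub'] := link_supp SC C0.
by rewrite monD //; congr (_ *: mon _); rewrite addmBA // submK.
Qed.

Lemma apply_diff_sum (I : Type) (r : seq I) (F : I -> ix S' -> pv_type k) :
  apply_diff (fun p => \sum_(i <- r) F i p) = fun q => \sum_(i <- r) apply_diff (F i) q.
Proof.
apply: funext => q; rewrite /apply_diff exchange_big /=.
by apply: eq_bigr => p _; rewrite mulr_suml.
Qed.

Lemma apply_diff_decomposition v :
  apply_diff v = fun q => \sum_(d <- degrees v) embed d (lincomb (component d v) C) q.
Proof.
rewrite {1}(embed_component v) apply_diff_sum; apply: funext => q.
by apply: eq_bigr => d _; rewrite apply_diff_embed // => p /component_supp.
Qed.

Lemma lincomb_insupp d c : (forall p, c p != 0 -> insupp pv_lat d p) ->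
  forall q, lincomb c C q != 0 -> insupp pv_lat d q.
Proof.
move=> sc q nz; have [p /andP[c0 C0]|no] := pickP (fun p => (c p != 0) && (C p q != 0)).
  have /andP[le lsub] := sc p c0; have /andP[le' lsub'] := link_supp SC C0.
  rewrite /insupp (lepm_trans le' le) /= -(submK le) -addmBA //.
  exact: pv_latD.
case/eqP: nz; rewrite /lincomb big1 // => p _; apply/eqP; rewrite mulf_eq0.
by apply: contraFT (no p); rewrite negb_or.
Qed.

Lemma component_apply_diff d v : component d (apply_diff v) = lincomb (component d v) C.
Proof.
rewrite apply_diff_decomposition component_sum; apply: funext => q.
transitivity (\sum_(d' <- degrees v | d' == d) lincomb (component d v) C q).
  rewrite [RHS]big_mkcond; apply: eq_bigr => d' _.
  rewrite component_embed; last by apply: lincomb_insupp => p /component_supp.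
  by have [->|] := eqVneq d' d.
rewrite big_pred1_uniq ?undup_uniq //; case: ifP => // ndv.
rewrite /lincomb big1 // => p _; apply/eqP; rewrite mulf_eq0; apply/orP; left.
by apply/negPn; apply: contraFN ndv; exact: component_degrees.
Qed.

Lemma apply_diff_eq0 v :
  (forall q, apply_diff v q = 0) <-> forall d, syz d (component d v).
Proof.
split=> [v0 d|sv q].
  apply/(link_ker SC); split=> [p /component_supp//|q].
  rewrite -component_apply_diff /component; case: ifP => // _.
  by rewrite v0 mcoeff0.
rewrite apply_diff_decomposition big1 // => d _.
by have /(link_ker SC)[_ E] := sv d; rewrite /embed E scale0r.
Qed.

(** Preimages are chosen in each multidegree and summed over the finite list [degrees v]. *)
Lemma apply_diff_image v :
  (exists w, v = apply_diff w) <-> forall d, syz d (component d v).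
Proof.
split=> [[w ->] d|sv].
  rewrite component_apply_diff; apply/(link_image SC).
  by exists (component d w) => // p /component_supp.
have lift d : exists c', (forall p, c' p != 0 -> insupp pv_lat d p)
    /\ component d v = lincomb c' C.
  by have /(link_image SC)[c' sc' E] := sv d; exists c'.
have [c' c'P] := choice lift.
exists (fun p => \sum_(d <- degrees v) embed d (c' d) p).
rewrite apply_diff_sum [LHS]embed_component; apply: funext => q; apply: eq_bigr => d _.
by have [sc' ->] := c'P d; rewrite apply_diff_embed.
Qed.

End PinchedVeroneseStages.

(** * The resolution *)

Section PinchedVeroneseResolution.
Variable k : fieldType.

Lemma pv_gpart_zero n : pv_gpart n (0 : pv_type k).
Proof. by exists 0; [exact: rpred0 | apply: val_inj; rewrite /= raddf0]. Qed.

Lemma gpartS_coef0 n (f : pv_type k) : pv_gpart n.+1 f -> (pv_val f)@_0%MM = 0.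
Proof.
move=> [q /pv_eval_homog/dhomogP qh ->]; apply: memN_msupp_eq0; apply/negP.
by move=> /qh/(congr1 (leq 1)); rewrite lt0n mdeg_eq0 eqxx.
Qed.

Lemma irrelevantP (f : pinchedVeronese k) :
  irrelevant f <-> (pv_val f)@_0%MM = 0.
Proof.
split=> [[n [y [hy ->]]]|f0].
  rewrite [pv_val _]pv_val_sum raddf_sum big1 // => i _ /=.
  exact: (gpartS_coef0 (hy i)).
have [n [y [hy fE]]] := @gpart_span k (pinchedVeronese k) f.
have y0 : (0 < n)%N -> y 0%N = 0.
  move=> n0; have /pv_gpart0[c yE] := hy 0%N; move: f0.
  rewrite fE [pv_val _]pv_val_sum raddf_sum /=; case: n n0 {fE} => // n _.
  rewrite big_ord_recl /= big1 => [|i _]; last first.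
    exact: (gpartS_coef0 (hy i.+1)).
  have -> : pv_val (y 0%N) = c%:MP.
    by rewrite yE pv_valZ -mul_mpolyC; exact: mulr1.
  by rewrite addr0 mcoeffC eqxx mulr1 yE => ->; rewrite scale0r.
exists n.-1, (fun i => y i.+1); split=> [i|]; first exact: hy.
case: n fE y0 => [|n] -> y0 /=; first by rewrite !big_ord0.
by rewrite big_ord_recl y0 // add0r.
Qed.

Definition pv_stage_ok (S : stage k 3 nat) : Prop :=
  stage_ok pv_lat pv_weight pv_gen pv_out S.

Lemma pv_stage_step (X : {S | pv_stage_ok S}) : exists Y : {S | pv_stage_ok S},
  exists C : ix (sval Y) -> ix (sval X) -> k, stage_link pv_lat pv_gen pv_out C.
Proof.
have [S' [C [ok link]]] := stage_step pv_lat0 pv_latD pv_lat_gen pv_weight0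
  pv_weightD pv_linear_quotients (svalP X).
by exists (exist _ S' ok), C.
Qed.

Fixpoint pv_stage (i : nat) : {S | pv_stage_ok S} :=
  if i is j.+1 then sval (cid (pv_stage_step (pv_stage j)))
  else exist _ (stage0 k pv_lat 0%N) (stage0_ok k pv_latD pv_root).

Definition pv_ix (i : nat) : finType := ix (sval (pv_stage i)).

Definition pv_coef (i : nat) : pv_ix i.+1 -> pv_ix i -> k :=
  sval (cid (svalP (cid (pv_stage_step (pv_stage i))))).

Lemma pv_coef_link i : stage_link pv_lat pv_gen pv_out (@pv_coef i).
Proof. exact: (svalP (cid (svalP (cid (pv_stage_step (pv_stage i)))))). Qed.

(** This is the linearity of the resolution: each stage adds one generator, of degree 3 in
    k[X, Y, Z] and degree 1 in R. *)
Lemma mdeg_pv_ix i (p : pv_ix i) : mdeg (gam p) = (3 * i)%N.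
Proof.
elim: i p => [|i IH] p; first by rewrite mdeg0.
have [q [s [j ->]]] := link_gam (pv_coef_link i) p; rewrite mdegD IH mdeg_pv_gen.
  by rewrite mulnSr.
by apply: (allP (automaton_gens s)); exact: mem_tnth.
Qed.

Definition pv_entry (i : nat) : pv_ix i.+1 -> pv_ix i -> pv_type k :=
  diff_entry (@pv_coef i).

Lemma pv_entry_gpart i (p : pv_ix i.+1) (q : pv_ix i) : pv_gpart 1 (pv_entry p q).
Proof.
rewrite /pv_entry /diff_entry; have [->|C0] := eqVneq (pv_coef p q) 0.
  by rewrite scale0r; exact: pv_gpart_zero.
have /andP[le lat] := link_supp (pv_coef_link i) C0.
rewrite -[X in pv_gpart _ X]addr0; apply: pv_gpart_lin (pv_gpart_zero _); apply: mon_gpart => //.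
by have := congr1 mdeg (submK le); rewrite mdegD !mdeg_pv_ix; lia.
Qed.

Definition pv_diff (i : nat) : 'M[pinchedVeronese k]_(#|pv_ix i.+1|, #|pv_ix i|) :=
  \matrix_(p, q) pv_entry (enum_val p) (enum_val q).

Definition unrow i (v : 'rV[pinchedVeronese k]_#|pv_ix i|) : pv_ix i -> pv_type k :=
  fun q => v ord0 (enum_rank q).

Lemma unrow_inj i : injective (@unrow i).
Proof.
move=> v v' E; apply/rowP => j; have := congr1 (fun f => f (enum_val j)) E.
by rewrite /unrow enum_valK.
Qed.

Lemma unrowK i (w : pv_ix i -> pv_type k) : exists v, @unrow i v = w.
Proof.
exists (\row_j w (enum_val j)); apply: funext => q.
by rewrite /unrow mxE enum_rankK.
Qed.

Lemma unrow_diff i v : unrow (v *m pv_diff i) = apply_diff (@pv_coef i) (unrow v).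
Proof.
apply: funext => q; rewrite /unrow /apply_diff mxE.
rewrite (reindex enum_rank) /=; last by apply: onW_bij; exact: enum_rank_bij.
by apply: eq_bigr => p _; rewrite mxE !enum_rankK.
Qed.

Lemma pv_diff_eq0 i v : v *m pv_diff i = 0 <->
  forall d, syz (s := sval (pv_stage i.+1)) d (component d (unrow v)).
Proof.
rewrite -(apply_diff_eq0 (pv_coef_link i)) -unrow_diff; split=> [-> q|v0].
  by rewrite /unrow mxE.
by apply: unrow_inj; apply: funext => q; rewrite v0 /unrow mxE.
Qed.

Lemma pv_diff_image i v : (exists w, v = w *m pv_diff i) <->
  forall d, syz (s := sval (pv_stage i)) d (component d (unrow v)).
Proof.
rewrite -(apply_diff_image (pv_coef_link i)); split=> [[w ->]|[w E]].
  by exists (unrow w); rewrite unrow_diff.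
have [w' wE] := unrowK w; exists w'.
by apply: unrow_inj; rewrite unrow_diff wE.
Qed.

Definition pv_aug : 'cV[pinchedVeronese k]_#|pv_ix 0| := const_mx 1.

Lemma pv_augE (v : 'rV[pinchedVeronese k]_#|pv_ix 0|) : (v *m pv_aug) ord0 ord0 = unrow v tt.
Proof.
rewrite mxE (reindex enum_rank) /=; last by apply: onW_bij; exact: enum_rank_bij.
by rewrite (bigD1 tt) //= big1 => [|[]//]; rewrite mxE mulr1 addr0.
Qed.

Lemma pv_aug_onto : exists v : 'rV[pinchedVeronese k]_#|pv_ix 0|,
  irrelevant (1 - (v *m pv_aug) ord0 ord0).
Proof.
have [v vE] := @unrowK 0 (fun=> 1); exists v; rewrite pv_augE vE subrr.
exists 0%N, (fun=> 0); split=> [i|]; last by rewrite big_ord0.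
exact: pv_gpart_zero.
Qed.

Lemma pv_exact0 (v : 'rV[pinchedVeronese k]_#|pv_ix 0|) : irrelevant ((v *m pv_aug) ord0 ord0) <->
  exists w, v = w *m pv_diff 0.
Proof.
rewrite pv_augE irrelevantP pv_diff_image /=; split=> [v0 d /=|sv].
  rewrite /component /= => nz; have := nz; case: ifP; rewrite ?eqxx // subm0 => _ nz'.
  rewrite (pv_support nz') /=; apply: contraNneq nz' => ->; apply/eqP; exact: v0.
apply/eqP/negPn/negP => nz; have := sv 0%MM.
by rewrite /component /= lepm_refl subm0 eqxx andbF => /(_ nz).
Qed.

Lemma pv_exactS i (v : 'rV[pinchedVeronese k]_#|pv_ix i.+1|) : v *m pv_diff i = 0 <-> exists w, v = w *m pv_diff i.+1.
Proof. by rewrite pv_diff_eq0 pv_diff_image. Qed.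

Lemma pv_diff_homog i p q :
  @gpartz k (pinchedVeronese k) (i.+1%:Z - i%:Z) (pv_diff i p q).
Proof.
have -> : i.+1%:Z - i%:Z = 1%:Z by lia.
by rewrite mxE; exact: pv_entry_gpart.
Qed.

Lemma pv_aug_homog p : @gpartz k (pinchedVeronese k) 0%:Z (pv_aug p ord0).
Proof. by rewrite mxE; apply/pv_gpart0; exists 1; rewrite scale1r. Qed.

Definition pv_resolution : gradedFreeResolution (pinchedVeronese k) :=
  @GradedFreeResolution k (pinchedVeronese k) (fun i => #|pv_ix i|) (fun i _ => i%:Z)
    pv_diff pv_aug pv_diff_homog pv_aug_homog pv_aug_onto pv_exact0 pv_exactS.

End PinchedVeroneseResolution.

Theorem theorem3p1 (k : fieldType) : koszul (pinchedVeronese k).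
Proof. by exists (pv_resolution k). Qed.
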